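(* Let Assumptions A and B (see context) hold, let $a=\|\Gamma\|$, and let $x^*$ be the unique Nash equilibrium. Apply the synchronous inexact proximal best-response scheme with $\mathbb E[\|x_{i,0}-x_i^*\|]\le C$ for all $i$ and $\alpha_{i,k}=\eta^{k+1}$ for some $\eta\in(0,1)$, where each inexact proximal best-response solution is computed by the stochastic approximation scheme (SA) (see context). Let $Q_i=\frac{2M_i^2}{\mu^2}+2D_{X_i}^2$. (a) (Overall iteration complexity.) Let $c=\max\{a,\eta\}$, $q\in(c,1)$, $D=1/\ln\big((q/c)^e\big)$, where $e$ is the base of the natural logarithm. Then the number of projected stochastic gradient steps for player $i$ to compute an $\epsilon$-NE$_2$ is no greater than $$\ell_i(\eta)=\frac{Q_i}{\eta^4\ln(1/\eta^2)}\left(\frac{\sqrt N(C+D)}{\epsilon}\right)^{\frac{\ln(1/\eta^2)}{\ln(1/q)}}+\left\lceil\frac{\ln\left(\sqrt N(C+D)/\epsilon\right)}{\ln(1/q)}\right\rceil .$$ (b) (Bounds on complexity.) The expression $\ell_i(\eta)$ satisfies $\ell_i(\eta)=\Omega(1/\epsilon^2)$. Moreover, for any given $\delta>0$, setting $\eta=a$ and $D=\frac{1+2\delta^{-1}}{e\ln(a^{-1})}$ (i.e. taking the $q\in(a,1)$ for which $1/\ln((q/a)^e)$ equals this value), $$\ell_i(a)\le\frac{Q_i}{a^4\ln(1/a^2)}\left(\frac{\sqrt N(C+D)}{\epsilon}\right)^{2+\delta}+\left\lceil\ln\left(\frac{\sqrt N(C+D)}{\epsilon}\right)\frac{2+\delta}{2\ln(a^{-1})}\right\rceil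 .$$
   Context: Game. There are $N$ players $\mathcal N=\{1,\dots,N\}$. Player $i$ has strategy set $X_i\subseteq\mathbb R^{n_i}$; $X=\prod_i X_i$, $X_{-i}=\prod_{j\ne i}X_j$, $x_{-i}=(x_j)_{j\ne i}$. Let $\xi:\Omega\to\mathbb R^d$ be a random vector on a probability space $(\Omega,\mathcal F,\mathbb P)$. Given $x_{-i}\in X_{-i}$, player $i$ minimizes over $x_i\in X_i$ the function $f_i(x_i,x_{-i})=\mathbb E[\psi_i(x_i,x_{-i};\xi)]$. A Nash equilibrium is a point $x^*\in X$ such that, for every $i$, $x_i^*$ minimizes $f_i(\cdot,x_{-i}^* )$ over $X_i$. $\|\cdot\|$ is the Euclidean norm for vectors and the induced spectral norm for matrices. $D_{X_i}=\sup\{\|x_i-x_i'\|:x_i,x_i'\in X_i\}$. Assumption A. For every $i$: (a) $X_i$ is closed, compact and convex; (b) for every $x_{-i}\in X_{-i}$, $f_i(\cdot,x_{-i})$ is convex and twice continuously differentiable on an open set containing $X_i$; moreover $f_i$ is twice differentiable in $x$; (c) for all $x_{-i}\in X_{-i}$ and all $\omega\in\Omega$, $\psi_i(\cdot,x_{-i};\xi(\omega))$ is differentiable on an open set containing $X_i$, and $\nabla_{x_i}f_i(x_i,x_{-i})=\mathbb E[\nabla_{x_i}\psi_i(x_i,x_{-i};\xi)]$; (d) there is $M_i>0$ with $\mathbb E[\|\nabla_{x_i}\psi_i(x_i,x_{-i};\xi)\|^2]\le M_i^2$ for all $x\in X$. Proximal best-response. Fix $\mu>0$. For $y\in X$, $\hat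 x_i(y)=\operatorname{argmin}_{x_i\in X_i}\left[f_i(x_i,y_{-i})+\frac{\mu}{2}\|x_i-y_i\|^2\right]$. Matrix $\Gamma$. Let $\zeta_{i,\min}=\inf_{x\in X}\lambda_{\min}(\nabla^2_{x_i}f_i(x))$ and $\zeta_{ij,\max}=\sup_{x\in X}\|\nabla^2_{x_ix_j}f_i(x)\|$ for $j\ne i$, where $\lambda_{\min}(A)$ is the smallest eigenvalue of $(A+A^T)/2$. $\Gamma\in\mathbb R^{N\times N}$ has entries $\Gamma_{ii}=\frac{\mu}{\mu+\zeta_{i,\min}}$ and $\Gamma_{ij}=\frac{\zeta_{ij,\max}}{\mu+\zeta_{i,\min}}$ for $j\neq i$. Assumption B. $\|\Gamma\|<1$. (Under Assumptions A and B the game has a unique Nash equilibrium $x^*$.) Synchronous inexact proximal best-response scheme. Start from $x_{i,0}\in X_i$ (possibly random). At each major iteration $k=0,1,\dots$ every player $i$ computes $x_{i,k+1}\in X_i$ satisfying the inexactness requirement $\mathbb E[\|x_{i,k+1}-\hat x_i(x_k)\|^2\mid\mathcal F_k]\le\alpha_{i,k}^2$ almost surely, $x_k=(x_{1,k},\dots,x_{N,k})$. Scheme (SA). At major iteration $k$, player $i$ takes projected stochastic gradient steps $t=1,\dots,j_{i,k}$, where $j_{i,k}$ steps suffice to obtain an inexact solution of accuracy $\alpha_{i,k}$: $z_{i,1}=x_{i,k}$, $$z_{i,t+1}=\Pi_{X_i}\left[z_{i,t}-\gamma_t\left(\nabla_{x_i}\psi_i(z_{i,t},x_{-i,k};\xi_{i,k}^t)+\mu(z_{i,t}-x_{i,k})\right)\right],\qquad\gamma_t=\frac{1}{\mu(t+1)},$$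 and $x_{i,k+1}=z_{i,j_{i,k}}$, where $\Pi_{X_i}$ is Euclidean projection onto $X_i$. Here $\xi_{i,k}^t$ are samples of $\xi$, and $\nabla_{x_i}\psi_i(z_{i,t},x_{-i,k};\xi_{i,k}^t)$ is the sampled gradient at $(z_{i,t},x_{-i,k})$ returned by a stochastic oracle, an unbiased estimator of $\nabla_{x_i}f_i(z_{i,t},x_{-i,k})$. $\mathcal F_k=\sigma\{x_0,\ \xi_{i,l}^1,\dots,\xi_{i,l}^{j_{i,l}},\ i\in\mathcal N,\ 0\le l\le k-1\}$. The number of projected stochastic gradient steps of player $i$ is the total of the $j_{i,k}$ over the major iterations carried out. A random strategy profile $x$ is an $\epsilon$-NE$_2$ if $\mathbb E\left[\big(\sum_{i=1}^N\|x_i-x_i^*\|^2\big)^{1/2}\right]\le\epsilon$.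
   Formalization: Part (a) is stated for ε ≤ √N(C+D) (beyond it ℓ_i can be negative) and, when x_0 is random with E[(Σ_i‖x_{i,0}−x_i^*‖²)^{1/2}] > √N·C, only for all sufficiently small ε, since the literal claim can fail there. *)

(* Defs.v *)
(* MathComp-Analysis development, over an abstract [R : realType]. *)
From HB Require Import structures.
From mathcomp Require Import all_boot all_order all_algebra.
From mathcomp Require Import all_classical all_reals all_analysis.

Set Implicit Arguments.
Unset Strict Implicit.
Unset Printing Implicit Defensive.

Import Order.TTheory GRing.Theory Num.Theory.
Import numFieldNormedType.Exports.

Local Open Scope classical_set_scope.
Local Open Scope ring_scope.

(* The library norm on ['rV[R]_m] is the max norm; it only provides the
   topology and differentiability here, which do not depend on that choice. *)
Definition enorm (R : realType) (m : nat) (v : 'rV[R]_m) : R :=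
  Num.sqrt (\sum_(c < m) v 0 c ^+ 2).

Definition specnorm (R : realType) (m p : nat) (A : 'M[R]_(m, p)) : R :=
  sup [set enorm (v *m A^T) | v in [set v : 'rV[R]_p | enorm v <= 1]].

Definition lambda_min (R : realType) (m : nat) (A : 'M[R]_m) : R :=
  inf [set l | eigenvalue (2^-1 *: (A + A^T)) l].

Definition diam (R : realType) (m : nat) (A : set 'rV[R]_m) : R :=
  sup [set enorm (z.1 - z.2) | z in A `*` A].

Definition proj (R : realType) (m : nat) (A : set 'rV[R]_m) (y : 'rV[R]_m) :
    'rV[R]_m :=
  xget 0 [set p | A p /\ forall z, A z -> enorm (y - p) <= enorm (y - z)].

Definition grad (R : realType) (m : nat) (g : 'rV[R]_m -> R) (z : 'rV[R]_m) :
    'rV[R]_m :=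
  \row_c 'D_(delta_mx 0 c) g z.

Definition C2_on (R : realType) (m : nat) (U : set 'rV[R]_m)
    (g : 'rV[R]_m -> R) : Prop :=
  forall z, U z ->
    [/\ differentiable g z,
        differentiable (grad g) z
      & forall b c, {for z, continuous
          (fun y => 'D_(delta_mx 0 c) (fun y' => grad g y' 0 b) y)}].

Definition twice_differentiable (R : realType) (m : nat)
    (g : 'rV[R]_m -> R) (z : 'rV[R]_m) : Prop :=
  (\forall y \near z, differentiable g y) /\ differentiable (grad g) z.

(* [Y] is a version of E[X | g_sys], for [g_sys] a sigma-algebra contained in the
   ambient one. *)
Definition is_cond_exp (R : realType) (d : measure_display)
    (T : measurableType d) (P : probability T R) (g_sys : set (set T))
    (X Y : T -> R) : Prop :=
  [/\ forall B : set R, measurable B -> g_sys (Y @^-1` B),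
      P.-integrable setT (EFin \o Y)
    & forall A, g_sys A ->
        (\int[P]_(w in A) (Y w)%:E = \int[P]_(w in A) (X w)%:E)%E].

Definition cond_exp_le (R : realType) (d : measure_display)
    (T : measurableType d) (P : probability T R) (g_sys : set (set T))
    (X : T -> R) (r : R) : Prop :=
  exists2 Y, is_cond_exp P g_sys X Y & {ae P, forall w, Y w <= r}.

(* A strategy profile is a single row vector whose [i]-th block is the
   strategy of player [i]; points of R^d are [d]-tuples, which carry the
   product Borel sigma-algebra. *)
Record sgame (R : realType) (d : measure_display) (T : measurableType d)
    (P : probability T R) := SGame {
  nplayers : nat ;
  sdim : 'I_nplayers -> nat ;
  strat : forall i : 'I_nplayers, set 'rV[R]_(sdim i) ;
  xdim : nat ;
  xi : T -> xdim.-tuple R ;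
  psi : 'I_nplayers -> 'rV[R]_(\sum_i sdim i) -> xdim.-tuple R -> R ;
  measurable_xi : measurable_fun setT xi
}.

Section Game.
Context {R : realType} {d : measure_display} {T : measurableType d}
  {P : probability T R} (G : sgame P).

Local Notation player := 'I_(nplayers G).

Definition profile := 'rV[R]_(\sum_i sdim (s := G) i).

Definition blk (x : profile) (i : player) : 'rV[R]_(sdim i) := submxrow x i.

Definition repl (x : profile) (i : player) (z : 'rV[R]_(sdim i)) : profile :=
  \mxrow_j dfwith (blk x) i z j.

Definition feasible (x : profile) : Prop := forall i, strat (blk x i).

(* Only the blocks of [x] other than the [i]-th one are constrained. *)
Definition rivals_feasible (i : player) (x : profile) : Prop :=
  forall j, j != i -> strat (blk x j).

Definition f (i : player) (x : profile) : R :=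
  fine 'E_P[fun w => psi i x (xi G w)].

Definition pgrad (i : player) (g : profile -> R) (x : profile) :
    'rV[R]_(sdim i) :=
  grad (fun z => g (repl x z)) (blk x i).

Definition hess (i j : player) (g : profile -> R) (x : profile) :
    'M[R]_(sdim i, sdim j) :=
  \matrix_(b, c) pgrad j (fun y => pgrad i g y 0 b) x 0 c.

Definition nash (x : profile) : Prop :=
  feasible x /\
  forall i z, strat z -> f i x <= f i (repl (i := i) x z).

(* Tacit in the model: expected losses exist and sampled gradients are random
   vectors. *)
Definition well_posed : Prop :=
  (forall i x, feasible x ->
     P.-integrable setT (fun w => (psi i x (xi G w))%:E)) /\
  (forall (i : player) (c : 'I_(sdim i)),
     measurable_fun
       [set u : (\sum_j sdim (s := G) j)%N.-tuple R * (xdim G).-tuple R |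
          feasible (\row_b tnth u.1 b)]
       (fun u => pgrad i (fun y => psi i y u.2) (\row_b tnth u.1 b) 0 c)).

Definition assumptionA (M : player -> R) : Prop :=
  forall i : player,
  [/\ [/\ closed (strat (i := i)), compact (strat (i := i))
        & convex_set (strat (i := i))],
      (forall x, rivals_feasible i x ->
         exists U : set 'rV[R]_(sdim i),
           [/\ open U, convex_set U, strat (i := i) `<=` U,
               convex_function U (fun z => f i (repl x z))
             & C2_on U (fun z => f i (repl x z))]) /\
      (forall x, feasible x -> twice_differentiable (f i) x),
      (forall x w, rivals_feasible i x ->
         exists U : set 'rV[R]_(sdim i),
           [/\ open U, strat (i := i) `<=` U
             & forall z, U z ->
                 differentiable (fun z' => psi i (repl x z') (xi G w)) z]) /\
      (forall x c, feasible x ->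
         (pgrad i (f i) x 0 c)%R%:E =
         'E_P[fun w => (pgrad i (fun y => psi i y (xi G w)) x 0 c)%R])%E
    & 0 < M i /\
      (forall x, feasible x ->
         ('E_P[fun w => (enorm (pgrad i (fun y => psi i y (xi G w)) x) ^+ 2)%R]
          <= (M i ^+ 2)%:E)%E)].

Section Prox.
Variable mu : R.

Definition prox_br (y : profile) (i : player) : 'rV[R]_(sdim i) :=
  let obj z := f i (repl y z) + mu / 2 * enorm (z - blk y i) ^+ 2 in
  xget 0 [set z | strat z /\ forall z', strat z' -> obj z <= obj z'].

Definition zeta_min (i : player) : R :=
  inf [set lambda_min (hess i i (f i) x) | x in feasible].

Definition cross_hess_norms (i j : player) : set R :=
  [set specnorm (hess i j (f i) x) | x in feasible].

Definition zeta_max (i j : player) : R := sup (cross_hess_norms i j).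

Definition Gamma : 'M[R]_(nplayers G) :=
  \matrix_(i, j) ((if i == j then mu else zeta_max i j) / (mu + zeta_min i)).

(* [sup] of an unbounded set is 0 here, so the finiteness of the suprema entering
   [Gamma] has to be spelled out. *)
Definition assumptionB : Prop :=
  (forall i j, j != i -> has_ubound (cross_hess_norms i j)) /\
  specnorm Gamma < 1.

(* [sa_inner i x s r] is z_(i, r + 1), started at z_(i, 1) = x_i, where [s t]
   is the sample used in step t. *)
Fixpoint sa_inner (i : player) (x : profile) (s : nat -> (xdim G).-tuple R)
    (r : nat) : 'rV[R]_(sdim i) :=
  if r is t.+1 then
    let z := sa_inner i x s t in
    let gamma := 1 / (mu * (t.+2)%:R) in
    proj (strat (i := i))
      (z - gamma *: (pgrad i (fun y => psi i y (s t.+1)) (repl x z)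
                     + mu *: (z - blk x i)))
  else blk x i.

Section Run.
Variables (j : player -> nat -> nat) (x0 : T -> profile)
  (smp : player -> nat -> nat -> T -> (xdim G).-tuple R).

Fixpoint sa_iter (k : nat) (w : T) : profile :=
  if k is l.+1 then
    let x := sa_iter l w in
    \mxrow_i sa_inner i x (fun t => smp i l t w) (j i l).-1
  else x0 w.

Definition history_gen (k : nat) : set (set T) :=
  [set A | (exists c, preimage_set_system setT (fun w => x0 w 0 c)
                        (@measurable _ R) A) \/
           (exists i l t, [/\ (l < k)%N, (0 < t <= j i l)%N &
              preimage_set_system setT (smp i l t) measurable A])].

Definition history (k : nat) : set (set T) := <<s history_gen k >>.

Definition inner_history (i : player) (k t : nat) : set (set T) :=
  <<s history_gen k `|`
      [set A | exists2 s, (0 < s < t)%N &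
         preimage_set_system setT (smp i k s) measurable A] >>.

(* Each sample is distributed as [xi] and is drawn independently of everything
   player [i] has used so far; this is what makes the sampled gradient an
   unbiased estimator at the current (random) point.  Samples of different
   players within one major iteration need not be independent. *)
Definition sa_run : Prop :=
  [/\ forall c, measurable_fun setT (fun w => x0 w 0 c),
      forall w, feasible (x0 w)
    & forall i k t, (0 < t <= j i k)%N ->
      [/\ measurable_fun setT (smp i k t),
          forall B, measurable B -> P (smp i k t @^-1` B) = P (xi G @^-1` B)
        & forall A B, inner_history i k t A -> measurable B ->
            P (A `&` smp i k t @^-1` B) = (P A * P (smp i k t @^-1` B))%E]].

Definition inexact (alpha : player -> nat -> R) : Prop :=
  forall i k, cond_exp_le P (history k)
    (fun w => enorm (blk (sa_iter k.+1 w) i - prox_br (sa_iter k w) i) ^+ 2)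
    (alpha i k ^+ 2).

End Run.
End Prox.

Definition mean_dist (xs : profile) (x : T -> profile) : \bar R :=
  'E_P[fun w => Num.sqrt (\sum_i enorm (blk (x w) i - blk xs i) ^+ 2)].

Definition eps_NE2 (xs : profile) (eps : R) (x : T -> profile) : Prop :=
  (mean_dist xs x <= eps%:E)%E.

Definition Qconst (mu : R) (M : player -> R) (i : player) : R :=
  2 * M i ^+ 2 / mu ^+ 2 + 2 * diam (strat (i := i)) ^+ 2.

End Game.

Definition Dconst (R : realType) (q c : R) : R :=
  1 / ln ((q / c) `^ expR 1).

Definition ell (R : realType) (N : nat) (Q C D eta q eps : R) : R :=
  let S := Num.sqrt N%:R * (C + D) / eps in
  Q / (eta ^+ 4 * ln (1 / eta ^+ 2)) * S `^ (ln (1 / eta ^+ 2) / ln (1 / q))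
  + (Num.ceil (ln S / ln (1 / q)))%:~R.

(* Main.v *)
(** Adding the variational inequalities that characterize two proximal best
    responses and applying the mean value theorem along the segment joining the
    two profiles gives
    |x^_i(y) - x^_i(y')| <= \sum_j Gamma_ij |y_j - y'_j|.  Since x^* is a fixed
    point of the proximal best response, the mean distance m_k to x^* satisfies
    m_(k+1) <= a m_k + sqrt N eta^(k+1), hence
    m_k <= sqrt N (C + k) c^k <= sqrt N (C + D) q^k.

    Inside a major iteration the objective is mu-strongly convex, so one
    projected stochastic gradient step with gamma_t = 1 / (mu (t + 1)) gives,
    conditionally on F_k, u_(t+1) <= (1 - 2 / (t + 1)) u_t + Q / (t + 1)^2 for
    the mean square error u_t, that is u_t <= Q / (t + 1).  Therefore
    j_k = O(Q / eta^(2 (k + 1))) steps reach accuracy eta^(k+1), and a geometric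
    sum over the ceil (ln S / ln (1 / q)) major iterations gives ell.  *)
Require Import Defs.
From HB Require Import structures.
From mathcomp Require Import all_boot all_order all_algebra.
From mathcomp Require Import all_classical all_reals all_analysis.
From mathcomp Require Import measurable_realfun ring lra.

Set Implicit Arguments.
Unset Strict Implicit.
Unset Printing Implicit Defensive.

Import Order.TTheory GRing.Theory Num.Theory.
Import numFieldNormedType.Exports.

Local Open Scope classical_set_scope.
Local Open Scope ring_scope.

(** The obstacle lies in the starting value. The hypothesis on [x0] bounds first moments block by
    block, which gives only [m_0 <= N C], whereas the rate [sqrt N (C + k) c^k] starts from
    [sqrt N C]. Part (a) therefore has two branches: either [mean_dist xs x0 <= sqrt N C] is given,
    or [eps] lies below a threshold [eps0], where the number [K] of major iterations is so large
    that [(C + D) (q/c)^K] absorbs [sqrt N C + K].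

    Inexactness controls a second moment while [mean_dist] is a first moment; an
    arithmetic-geometric inequality with a tuned weight bridges the two without loss.

    Inner estimates are stated as integrals over events of the history. They become conditional
    expectations only once, through Radon-Nikodym.

    Projections and proximal responses are picked by [xget], so their measurability has to be
    earned: it comes from Lipschitz estimates, and for the proximal response that estimate is the
    contraction inequality itself. *)

Local Notation proj := Defs.proj.

(** * Euclidean and spectral norms *)

Section Euclid.
Context {R : realType}.

Definition dotv (m : nat) (u v : 'rV[R]_m) : R := \sum_(c < m) u 0 c * v 0 c.

Section Fixed_dim.
Context {m : nat}.
Implicit Types u v w : 'rV[R]_m.

Lemma dotvC u v : dotv u v = dotv v u.
Proof. by apply: eq_bigr => c _; rewrite mulrC. Qed.

Lemma dotvDl u v w : dotv (u + v) w = dotv u w + dotv v w.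
Proof. by rewrite -big_split; apply: eq_bigr => c _; rewrite mxE mulrDl. Qed.

Lemma dotvZl (k : R) u w : dotv (k *: u) w = k * dotv u w.
Proof. by rewrite mulr_sumr; apply: eq_bigr => c _; rewrite mxE mulrA. Qed.

Lemma dotvNl u w : dotv (- u) w = - dotv u w.
Proof. by rewrite -scaleN1r dotvZl mulN1r. Qed.

Lemma dotvBl u v w : dotv (u - v) w = dotv u w - dotv v w.
Proof. by rewrite dotvDl dotvNl. Qed.

Lemma dotvDr w u v : dotv w (u + v) = dotv w u + dotv w v.
Proof. by rewrite !(dotvC w) dotvDl. Qed.

Lemma dotvZr (k : R) w u : dotv w (k *: u) = k * dotv w u.
Proof. by rewrite !(dotvC w) dotvZl. Qed.

Lemma dotvNr w u : dotv w (- u) = - dotv w u.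
Proof. by rewrite !(dotvC w) dotvNl. Qed.

Lemma dotvBr w u v : dotv w (u - v) = dotv w u - dotv w v.
Proof. by rewrite dotvDr dotvNr. Qed.

Lemma dotv0l w : dotv 0 w = 0.
Proof. by rewrite -(subrr 0) dotvBl subrr. Qed.

Lemma dotv0r w : dotv w 0 = 0.
Proof. by rewrite dotvC dotv0l. Qed.

Lemma dotvv_ge0 u : 0 <= dotv u u.
Proof. by apply: sumr_ge0 => c _; rewrite -expr2 sqr_ge0. Qed.

Lemma enorm_ge0 u : 0 <= enorm u.
Proof. exact: sqrtr_ge0. Qed.

Lemma enorm_sq u : enorm u ^+ 2 = dotv u u.
Proof.
rewrite /enorm sqr_sqrtr; first by apply: eq_bigr => c _; rewrite expr2.
by apply: sumr_ge0 => c _; exact: sqr_ge0.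
Qed.

Lemma enormE u : enorm u = Num.sqrt (dotv u u).
Proof. by rewrite -enorm_sq sqrtr_sqr ger0_norm ?enorm_ge0. Qed.

Lemma enorm0 : enorm (0 : 'rV[R]_m) = 0.
Proof. by rewrite enormE dotv0l sqrtr0. Qed.

Lemma enormZ (k : R) u : enorm (k *: u) = `|k| * enorm u.
Proof. by rewrite !enormE dotvZl dotvZr mulrA -expr2 sqrtrM ?sqr_ge0// sqrtr_sqr. Qed.

Lemma enormN u : enorm (- u) = enorm u.
Proof. by rewrite -scaleN1r enormZ normrN1 mul1r. Qed.

Lemma enormB u v : enorm (u - v) = enorm (v - u).
Proof. by rewrite -enormN opprB. Qed.

Lemma abs_coord_le_enorm u c : `|u 0 c| <= enorm u.
Proof.
rewrite -(ler_pXn2r (n := 2)) ?nnegrE ?enorm_ge0// enorm_sq real_normK ?num_real//.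
rewrite /dotv (bigD1 c)//= -expr2 lerDl.
by apply: sumr_ge0 => b _; rewrite -expr2 sqr_ge0.
Qed.

Lemma enorm_eq0 u : enorm u = 0 -> u = 0.
Proof.
move=> u0; apply/rowP => c; rewrite mxE; apply/eqP.
by rewrite -normr_le0 -u0; exact: abs_coord_le_enorm.
Qed.

Lemma enormD_sq u v : enorm (u + v) ^+ 2 = enorm u ^+ 2 + 2 * dotv u v + enorm v ^+ 2.
Proof. by rewrite !enorm_sq dotvDl !dotvDr (dotvC v u); ring. Qed.

Lemma enormB_sq u v : enorm (u - v) ^+ 2 = enorm u ^+ 2 - 2 * dotv u v + enorm v ^+ 2.
Proof. by rewrite enormD_sq dotvNr enormN; ring. Qed.

Lemma cauchy_schwarz u v : dotv u v <= enorm u * enorm v.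
Proof.
have [->|v0] := eqVneq v 0; first by rewrite dotv0r enorm0 mulr0.
have v1 : 0 < enorm v.
  by rewrite lt_neqAle enorm_ge0 andbT eq_sym; apply: contra_neq v0; exact: enorm_eq0.
have [->|u0] := eqVneq u 0; first by rewrite dotv0l enorm0 mul0r.
have u1 : 0 < enorm u.
  by rewrite lt_neqAle enorm_ge0 andbT eq_sym; apply: contra_neq u0; exact: enorm_eq0.
(* This square equals [2 |u| |v| (|u| |v| - dotv u v)]; the positive factor is divided out below. *)
have := sqr_ge0 (enorm (enorm v *: u - enorm u *: v)).
rewrite enormB_sq !enormZ !ger0_norm ?enorm_ge0// dotvZl dotvZr => H.
rewrite -(ler_pM2l (mulr_gt0 v1 u1)).
by move: H; nra.
Qed.

Lemma cauchy_schwarz_abs u v : `|dotv u v| <= enorm u * enorm v.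
Proof.
by rewrite ler_norml cauchy_schwarz andbT lerNl -dotvNl -(enormN u) cauchy_schwarz.
Qed.

Lemma ler_enormD u v : enorm (u + v) <= enorm u + enorm v.
Proof.
rewrite -(ler_pXn2r (n := 2)) ?nnegrE ?enorm_ge0 ?addr_ge0 ?enorm_ge0//.
by rewrite enormD_sq; have := cauchy_schwarz u v; nra.
Qed.

Lemma ler_enormB u v w : enorm (u - w) <= enorm (u - v) + enorm (v - w).
Proof. by apply: le_trans (ler_enormD _ _); rewrite addrA subrK. Qed.

Lemma enorm_le_sum u : enorm u <= \sum_c `|u 0 c|.
Proof.
rewrite -(ler_pXn2r (n := 2)) ?nnegrE ?enorm_ge0 ?sumr_ge0// enorm_sq expr2 mulr_suml.
apply: ler_sum => c _; rewrite -expr2 -real_normK ?num_real// expr2.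
apply: ler_wpM2l; first exact: normr_ge0.
by rewrite (bigD1 c)//= lerDl sumr_ge0.
Qed.

(** Passes from the componentwise bound by [Gamma] to Euclidean norms. *)
Lemma enorm_mono u v : (forall c, 0 <= u 0 c <= v 0 c) -> enorm u <= enorm v.
Proof.
move=> uv; rewrite !enormE ler_wsqrtr//; apply: ler_sum => c _.
by have /andP[u0 uv'] := uv c; apply: ler_pM.
Qed.

(** With [enorm_le_norm], this comparison carries boundedness and continuity between [enorm] and the
    max norm that defines the topology. *)
Lemma norm_le_enorm u : `|u| <= enorm u.
Proof.
have [->|u0] := eqVneq u 0; first by rewrite normr0 enorm0.
have : mx_norm u != 0 by apply: contra_neq u0; exact: mx_norm_eq0.
by move=> /mx_norm_neq0[[i c] /=]; rewrite /Num.norm/= => ->; rewrite (ord1 i) abs_coord_le_enorm.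
Qed.

Lemma enorm_le_norm u : enorm u <= m%:R * `|u|.
Proof.
apply: le_trans (enorm_le_sum u) _.
rewrite -[X in X%:R]card_ord -sum1_card natr_sum mulr_suml; apply: ler_sum => c _.
by rewrite mul1r /Num.norm/= mx_normrE; apply: (le_bigmax _ (fun i => `|u i.1 i.2|) (0, c)).
Qed.

Lemma dotv_delta u c : dotv u (delta_mx 0 c) = u 0 c.
Proof.
rewrite /dotv (bigD1 c)//= mxE !eqxx mulr1 big1 ?addr0// => b bc.
by rewrite mxE (negbTE bc) andbF mulr0.
Qed.

End Fixed_dim.

Lemma mulmx_dotv (m p : nat) (A : 'M[R]_(m, p)) (v : 'rV[R]_p) i :
  (v *m A^T) 0 i = dotv v (row i A).
Proof. by rewrite mxE; apply: eq_bigr => c _; rewrite !mxE. Qed.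

Lemma enorm_mulmx_bound (m p : nat) (A : 'M[R]_(m, p)) (v : 'rV[R]_p) :
  enorm (v *m A^T) <= (\sum_i enorm (row i A)) * enorm v.
Proof.
apply: le_trans (enorm_le_sum _) _; rewrite mulr_suml; apply: ler_sum => i _.
by rewrite mulmx_dotv mulrC; exact: cauchy_schwarz_abs.
Qed.

Lemma specnorm_has_sup (m p : nat) (A : 'M[R]_(m, p)) :
  has_sup [set enorm (v *m A^T) | v in [set v : 'rV[R]_p | enorm v <= 1]].
Proof.
split; first by exists (enorm ((0 : 'rV_p) *m A^T)); exists 0; rewrite //= enorm0.
exists (\sum_i enorm (row i A)) => _ [v /= v1 <-].
apply: le_trans (enorm_mulmx_bound _ _) _; rewrite ler_piMr//.
by apply: sumr_ge0 => i _; exact: enorm_ge0.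
Qed.

Lemma specnorm_ge0 (m p : nat) (A : 'M[R]_(m, p)) : 0 <= specnorm A.
Proof.
apply: sup_upper_bound; first exact: specnorm_has_sup.
by exists 0; rewrite /= ?mul0mx enorm0.
Qed.

Lemma enorm_mulmx_le (m p : nat) (A : 'M[R]_(m, p)) (v : 'rV[R]_p) :
  enorm (v *m A^T) <= specnorm A * enorm v.
Proof.
have [->|v0] := eqVneq v 0; first by rewrite mul0mx !enorm0 mulr0.
have v1 : 0 < enorm v.
  by rewrite lt_neqAle enorm_ge0 andbT eq_sym; apply: contra_neq v0; exact: enorm_eq0.
rewrite -ler_pdivrMr// mulrC -[(enorm v)^-1]ger0_norm ?invr_ge0 ?enorm_ge0// -enormZ.
rewrite scalemxAl; apply: sup_upper_bound; first exact: specnorm_has_sup.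
exists ((enorm v)^-1 *: v) => //=.
by rewrite enormZ ger0_norm ?invr_ge0 ?enorm_ge0// mulVf// gt_eqF.
Qed.

Lemma abs_entry_le_specnorm (m p : nat) (A : 'M[R]_(m, p)) i j :
  `|A i j| <= specnorm A.
Proof.
have := enorm_mulmx_le A (delta_mx 0 j).
have -> : enorm (delta_mx 0 j : 'rV[R]_p) = 1.
  by rewrite enormE dotv_delta mxE !eqxx sqrtr1.
rewrite mulr1; apply: le_trans; apply: le_trans (abs_coord_le_enorm _ i).
by rewrite mulmx_dotv dotvC dotv_delta mxE.
Qed.

Lemma specnorm_dotv_le (m p : nat) (A : 'M[R]_(m, p)) (u : 'rV[R]_m) (v : 'rV[R]_p) :
  `|dotv u (v *m A^T)| <= specnorm A * enorm u * enorm v.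
Proof.
apply: le_trans (cauchy_schwarz_abs _ _) _; rewrite [_ * enorm u]mulrC -mulrA.
by rewrite ler_wpM2l ?enorm_ge0// enorm_mulmx_le.
Qed.

Lemma sum_blocks (n : nat) (p_ : 'I_n -> nat) (F : 'I_(\sum_i p_ i) -> R) :
  \sum_c F c = \sum_i \sum_(b < p_ i) F (tagnat.Rank i b).
Proof.
rewrite sig_big_dep/= (reindex _ tagnat.sig_bij_on)/=; apply: eq_bigr => c _.
by rewrite tagnat.sig2K.
Qed.

Lemma dotv_blocks (n : nat) (p_ : 'I_n -> nat) (u v : 'rV[R]_(\sum_i p_ i)) :
  dotv u v = \sum_i dotv (submxrow u i) (submxrow v i).
Proof.
by rewrite /dotv sum_blocks; apply: eq_bigr => i _; apply: eq_bigr => b _; rewrite !mxE.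
Qed.

Lemma continuous_sumr (T : topologicalType) (I : Type) (r : seq I) (g : I -> T -> R) :
  (forall i, continuous (g i)) -> continuous (fun x => \sum_(i <- r) g i x).
Proof. by move=> gl x; apply: cvg_big => [|i _]; [exact: add_continuous|exact: gl]. Qed.

Lemma continuous_dotvl (m : nat) (w : 'rV[R]_m) : continuous (fun u : 'rV[R]_m => dotv u w).
Proof.
by apply: continuous_sumr => c u; apply: (@continuousM R _ (fun u : 'rV[R]_m => u 0 c) (fun=> w 0 c));
  [exact: coord_continuous|exact: cst_continuous].
Qed.

Lemma continuous_enorm (m : nat) : continuous (@enorm R m).
Proof.
move=> u; apply: (@continuous_comp _ _ _ (fun u : 'rV[R]_m => \sum_(c < m) u 0 c ^+ 2)).
  apply: continuous_sumr => c v.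
  apply: (@continuous_comp _ _ _ (fun u : 'rV[R]_m => u 0 c) (fun x => x ^+ 2)).
    exact: coord_continuous.
  exact: exprn_continuous.
exact: sqrt_continuous.
Qed.

End Euclid.

(** * Projections, variational inequalities, smallest eigenvalues *)

Section Convex.
Context {R : realType}.

(** First-order optimality without a limit: a comparison step of length [t] leaves an error [t * b],
    and [t = a / (a + b)] already contradicts [a > 0]. *)
Lemma le0_of_le_scaled (a b : R) :
  0 <= b -> (forall t, 0 < t <= 1 -> a <= t * b) -> a <= 0.
Proof.
move=> b0 H; rewrite leNgt; apply/negP => a0.
have ab0 : 0 < a + b by rewrite ltr_wpDr.
have /H : 0 < a / (a + b) <= 1.
  by rewrite divr_gt0//= ler_pdivrMr// mul1r lerDl.
by rewrite mulrAC ler_pdivlMr//; nra.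
Qed.

Section Rows.
Context {m : nat}.
Implicit Types (A U : set 'rV[R]_m) (F : 'rV[R]_m -> R).

Lemma convex_set_segment A x y (t : R) :
  convex_set A -> A x -> A y -> 0 <= t <= 1 -> A (x + t *: (y - x)).
Proof.
move=> cA Ax Ay /andP[t0 t1].
have := cA y x (Itv01 t0 t1) (mem_set Ay) (mem_set Ax).
rewrite inE; congr A.
rewrite /conv/= /unstable.onem/= scalerBl scale1r scalerBr addrC -addrA.
by congr (_ + _); rewrite addrC.
Qed.

Lemma proj_spec A y : compact A -> A !=set0 ->
  A (proj A y) /\ forall z, A z -> enorm (y - proj A y) <= enorm (y - z).
Proof.
move=> cA A0; apply: (@xgetPex _ _ [set p | A p /\ forall z, A z -> enorm (y - p) <= enorm (y - z)]).
have [|p /set_mem Ap Hp] := @EVT_min_rV R m (fun z => enorm (y - z)) A A0 cA.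
  apply: continuous_subspaceT => z.
  apply: (@continuous_comp _ _ _ (fun z : 'rV[R]_m => y - z) (@enorm R m) z); last exact: continuous_enorm.
  by apply: (@continuousB R _ _ (cst y) id z); [exact: cst_continuous|exact: cvg_id].
by exists p; split => // z Az; apply: Hp; rewrite inE.
Qed.

(** Moving a fraction [t] from the projection towards [z] cannot reduce the distance to [y];
    expanding the square leaves an error of order [t]. *)
Lemma proj_dotv_le0 A y z : compact A -> convex_set A -> A z ->
  dotv (y - proj A y) (z - proj A y) <= 0.
Proof.
move=> cA vA Az; have [|Ap Hp] := proj_spec y cA; first by exists z.
set p := proj A y in Ap Hp *.
suff H : 2 * dotv (y - p) (z - p) <= 0 by lra.
apply: (@le0_of_le_scaled _ (enorm (z - p) ^+ 2)); first exact: sqr_ge0.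
move=> t /andP[t0 t1].
have /Hp : A (p + t *: (z - p)) by apply: convex_set_segment => //; rewrite ltW.
rewrite -(ler_pXn2r (n := 2)) ?nnegrE ?enorm_ge0// opprD addrA => H.
have := enormB_sq (y - p) (t *: (z - p)); rewrite enormZ ger0_norm ?(ltW t0)// dotvZr => E.
move: H; rewrite {}E => H.
by rewrite -(ler_pM2l t0); move: H;  nra.
Qed.

(** The two obtuse-angle inequalities add up to [|p - p'|^2 <= dotv (y - y') (p - p')];
    Cauchy-Schwarz finishes. *)
Lemma proj_nonexpansive A y y' : compact A -> convex_set A -> A !=set0 ->
  enorm (proj A y - proj A y') <= enorm (y - y').
Proof.
move=> cA vA A0; have [Ap _] := proj_spec y cA A0; have [Ap' _] := proj_spec y' cA A0.
have H1 := proj_dotv_le0 y cA vA Ap'; have H2 := proj_dotv_le0 y' cA vA Ap.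
set p := proj A y in Ap H1 H2 *; set p' := proj A y' in Ap' H1 H2 *.
have [->|pp'] := eqVneq p p'; first by rewrite subrr enorm0 enorm_ge0.
have e0 : 0 < enorm (p - p').
  rewrite lt_neqAle enorm_ge0 andbT eq_sym; apply: contra_neq pp' => /enorm_eq0/eqP.
  by rewrite subr_eq0 => /eqP.
rewrite -(ler_pM2r e0); apply: le_trans (cauchy_schwarz _ _).
rewrite -expr2 enorm_sq; move: H1 H2.
have -> : p' - p = - (p - p') by rewrite opprB.
have -> : y - y' = ((y - p) - (y' - p')) + (p - p') by apply/rowP => c; rewrite !mxE; ring.
rewrite (dotvDl (y - p - _)); move: (p - p') (y - p) (y' - p') => v u u'.
by rewrite dotvNr dotvBl; lra.
Qed.

Lemma proj_id A y : compact A -> A y -> proj A y = y.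
Proof.
move=> cA Ay; have [|_ Hp] := proj_spec y cA; first by exists y.
have := Hp _ Ay; rewrite subrr enorm0 => H.
by apply/esym/eqP; rewrite -subr_eq0; apply/eqP/enorm_eq0/le_anti; rewrite H enorm_ge0.
Qed.

(** Convexity of a set or function controls only steps [t] in ]0, 1], so the derivative is read off
    as a right limit, after subtracting the vanishing term [h * c] from the quotient. *)
Lemma derive_le_quadratic F x v (b c : R) : derivable F x v ->
  (forall t, 0 < t <= 1 -> F (x + t *: v) - F x <= t * b + t ^+ 2 * c) ->
  'D_v F x <= b.
Proof.
move=> dF H.
have cF : h^-1 *: ((F \o shift x) (h *: v) - F x) - h * c @[h --> 0^'+] --> 'D_v F x - 0 * c.
  apply: cvgB; first exact: cvg_dnbhs_at_right.
  by apply: cvg_at_right_filter; apply: cvgM; [exact: cvg_id|exact: cvg_cst].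
rewrite mul0r subr0 in cF; apply: (cvgr_to_le cF).
near=> h.
have h0 : 0 < h by near: h; exact: nbhs_right_gt.
have h1 : h <= 1 by near: h; apply: nbhs_right_le.
have := H h; rewrite h0 h1 => /(_ isT).
rewrite /= [h *: v + x]addrC => {}H.
rewrite lerBlDr [_ *: _]mulrC ler_pdivrMr//; apply: le_trans H _.
by rewrite le_eqVlt; apply/orP; left; apply/eqP; ring.
Unshelve. all: by end_near. Qed.

Lemma convex_derive_le U F x y : convex_function U F -> U x -> U y ->
  derivable F x (y - x) -> 'D_(y - x) F x <= F y - F x.
Proof.
move=> cF Ux Uy dF; apply: (@derive_le_quadratic _ _ _ _ 0) => // t /andP[t0 t1].
have := cF (Itv01 (ltW t0) t1) y x (mem_set Uy) (mem_set Ux).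
rewrite convRE {1}/conv/= /unstable.onem/=.
have -> : t *: y + (1 - t) *: x = x + t *: (y - x).
  by rewrite scalerBl scale1r scalerBr addrC -addrA; congr (_ + _); rewrite addrC.
by move: (F (x + _)) => b; nra.
Qed.

Lemma deriveE_grad F x v : differentiable F x -> 'D_v F x = dotv (grad F x) v.
Proof.
move=> dF; rewrite deriveE// [in LHS](row_sum_delta v) linear_sum/=.
by apply: eq_bigr => c _; rewrite linearZ/= mxE deriveE// [LHS]mulrC.
Qed.

Lemma convex_grad_monotone U F x y : convex_function U F -> U x -> U y ->
  differentiable F x -> differentiable F y ->
  0 <= dotv (grad F x - grad F y) (x - y).
Proof.
move=> cF Ux Uy dx dy.
have := convex_derive_le cF Ux Uy (diff_derivable dx); rewrite deriveE_grad//.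
have := convex_derive_le cF Uy Ux (diff_derivable dy); rewrite deriveE_grad//.
by rewrite -[y - x]opprB dotvNr dotvBl; lra.
Qed.

Lemma prox_variational A F (mu : R) y p z : convex_set A -> A p -> A z ->
  differentiable F p ->
  (forall z, A z -> F p + mu / 2 * enorm (p - y) ^+ 2 <= F z + mu / 2 * enorm (z - y) ^+ 2) ->
  0 <= dotv (grad F p + mu *: (p - y)) (z - p).
Proof.
move=> vA Ap Az dF Hp.
(* Minimality of [p] limits the decrease of [F], that is the increase of [- F], which is what the
   upper bound on derivatives accepts. *)
have dN : derivable (- F) p (z - p) by apply: derivableN; exact: diff_derivable.
have : 'D_(z - p) (- F) p <= mu * dotv (p - y) (z - p).
  apply: (@derive_le_quadratic _ _ _ _ (mu / 2 * enorm (z - p) ^+ 2)) => // t /andP[t0 t1].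
  have /Hp : A (p + t *: (z - p)) by apply: convex_set_segment => //; rewrite ltW.
  rewrite [p + _ - y]addrAC (enormD_sq (p - y)) enormZ dotvZr ger0_norm ?(ltW t0)//.
  by rewrite !fctE/=; lra.
rewrite deriveN; last exact: diff_derivable.
by rewrite deriveE_grad// [X in _ -> 0 <= X]dotvDl dotvZl; lra.
Qed.

End Rows.

(** * Rayleigh quotient and smallest eigenvalue *)

Section Lambda_min.
Context {m : nat}.
Implicit Types A S : 'M[R]_m.

Lemma dotv_mulmx_tr A (u v : 'rV[R]_m) : dotv u (v *m A^T) = dotv (u *m A) v.
Proof.
have E (p q : 'rV[R]_m) : dotv p q = (p *m q^T) 0 0.
  by rewrite mxE; apply: eq_bigr => c _; rewrite mxE.
by rewrite !E trmx_mul trmxK mulmxA.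
Qed.

Lemma continuous_quadratic S : continuous (fun u : 'rV[R]_m => dotv u (u *m S)).
Proof.
apply: continuous_sumr => c u.
apply: (@continuousM R _ (fun u : 'rV[R]_m => u 0 c) (fun u : 'rV[R]_m => (u *m S) 0 c)).
  exact: coord_continuous.
have -> : (fun u0 : 'rV[R]_m => (u0 *m S) 0 c) = (fun u => dotv u (row c S^T)).
  by apply/funext => v; rewrite -mulmx_dotv trmxK.
exact: continuous_dotvl.
Qed.

Lemma compact_sphere : compact [set u : 'rV[R]_m | enorm u = 1].
Proof.
apply: bounded_closed_compact.
  exists 1; split => // M M1 u /= u1; apply: le_trans (norm_le_enorm _) _.
  by rewrite u1 ltW.
rewrite (_ : [set u | _] = @enorm R m @^-1` [set x | x = 1])//.
by apply: closed_comp => [u _|]; [exact: continuous_enorm|exact: closed_eq].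
Qed.

(* The Rayleigh quotient attains its minimum on the sphere, and a minimizer is
   an eigenvector. *)
Lemma rayleigh_min S : S^T = S -> (0 < m)%N ->
  exists2 l, eigenvalue S l & forall w, l * dotv w w <= dotv w (w *m S).
Proof.
move=> sS m0; pose q (u : 'rV[R]_m) := dotv u (u *m S).
have [||u /set_mem/= u1 Hu] := @EVT_min_rV R m q [set u | enorm u = 1] _ compact_sphere.
- by exists (delta_mx 0 (Ordinal m0)) => /=; rewrite enormE dotv_delta mxE !eqxx sqrtr1.
- by apply: continuous_subspaceT; exact: continuous_quadratic.
have Hq w : q u * dotv w w <= q w.
  have [->|w0] := eqVneq w 0; first by rewrite /q mul0mx !dotv0l mulr0.
  have w1 : 0 < enorm w.
    by rewrite lt_neqAle enorm_ge0 andbT eq_sym; apply: contra_neq w0; exact: enorm_eq0.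
  have := Hu ((enorm w)^-1 *: w).
  rewrite inE/= enormZ ger0_norm ?invr_ge0 ?enorm_ge0// mulVf ?gt_eqF// => /(_ erefl).
  rewrite /q -scalemxAl dotvZl dotvZr mulrA -invfM -expr2 mulrC.
  by rewrite ler_pdivlMr ?exprn_gt0// enorm_sq.
(* [g] is the residual of the eigenvalue equation. At [u - t g] the quantity [q - q u * |.|^2]
   equals [-2 t |g|^2] plus a multiple of [t^2], and it is never negative, so [g] vanishes. *)
have [g gE] : exists g, g = u *m S - q u *: u by eexists.
have uu : dotv u u = 1 by rewrite -enorm_sq u1 expr1n.
suff g0 : g = 0.
  exists (q u) => //; apply/eigenvalueP; exists u; first by apply/eqP; rewrite -subr_eq0 -gE g0.
  by apply/eqP => u0; move: u1; rewrite u0 enorm0 => /esym/eqP; rewrite oner_eq0.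
apply: enorm_eq0; apply/eqP; rewrite -sqrf_eq0 eq_le sqr_ge0 andbT.
suff : 2 * enorm g ^+ 2 <= 0 by lra.
apply: (@le0_of_le_scaled _ (q g - q u * dotv g g)); first by rewrite subr_ge0.
move=> t /andP[t0 t1].
have := Hq (u - t *: g); rewrite /q.
have sym (v w : 'rV[R]_m) : dotv v (w *m S) = dotv w (v *m S).
  by rewrite -[in LHS]sS dotv_mulmx_tr dotvC.
rewrite mulmxBl -scalemxAl !dotvBl !dotvBr !dotvZl !dotvZr (sym u g) uu (dotvC u g).
have -> : enorm g ^+ 2 = dotv g (u *m S) - q u * dotv g u.
  by rewrite enorm_sq {2}gE dotvBr dotvZr.
rewrite -!/(q _) => H.
by rewrite -(ler_pM2l t0); move: H; lra.
Qed.

Let symm A := 2^-1 *: (A + A^T).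

Let symm_quad A (v : 'rV[R]_m) : dotv v (v *m symm A) = dotv v (v *m A^T).
Proof.
rewrite /symm -scalemxAr mulmxDr dotvZr dotvDr.
have -> : dotv v (v *m A) = dotv v (v *m A^T) by rewrite dotv_mulmx_tr dotvC.
by lra.
Qed.

Let eigen_ge0 A l : (forall v, 0 <= dotv v (v *m A^T)) -> eigenvalue (symm A) l -> 0 <= l.
Proof.
move=> psd /eigenvalueP[v vl v0].
have w1 : 0 < enorm v.
  by rewrite lt_neqAle enorm_ge0 andbT eq_sym; apply: contra_neq v0; exact: enorm_eq0.
have := psd v; rewrite -symm_quad vl dotvZr -enorm_sq.
by rewrite pmulr_lge0// exprn_gt0.
Qed.

Lemma lambda_min_ge0 A : (forall v, 0 <= dotv v (v *m A^T)) -> 0 <= lambda_min A.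
Proof.
move=> psd; rewrite /lambda_min.
have [E0|/set0P E0] := eqVneq [set l | eigenvalue (symm A) l] set0.
  by rewrite -/(symm A) E0 inf0.
by apply: lb_le_inf => // l /= ?; exact: eigen_ge0 psd _.
Qed.

(** Positivity bounds the spectrum below by 0, so [inf] is a genuine infimum and lies below the
    eigenvalue supplied by [rayleigh_min]. *)
Lemma lambda_min_quadratic A v : (forall v, 0 <= dotv v (v *m A^T)) ->
  lambda_min A * enorm v ^+ 2 <= dotv v (v *m A^T).
Proof.
move=> psd; rewrite enorm_sq -symm_quad.
(* In dimension 0 there is no eigenvalue to compare with, but every vector is zero. *)
have [m0|m0] := posnP m.
  suff -> : v = 0 by rewrite !dotv0l mulr0.
  by apply/rowP => i; have := ltn_ord i; rewrite {2}m0.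
have [|l el Hl] := @rayleigh_min (symm A) _ m0.
  by rewrite /symm linearZ/= linearD/= trmxK addrC.
apply: le_trans (Hl v); apply: ler_wpM2r; first exact: dotvv_ge0.
by apply: ge_inf => //; exists 0 => l' /= ?; exact: eigen_ge0 psd _.
Qed.

End Lambda_min.
End Convex.

(** * Block derivatives of functions of a strategy profile *)

(** A directional derivative sees only values along a line. This moves derivatives between a block
    and the whole profile, or between a real parameter and a segment. *)
Lemma derive_congr (R : numFieldType) (V W U : normedModType R) (F : V -> U) (H : W -> U)
    (x v : V) (y w : W) : (forall h : R, F (h *: v + x) = H (h *: w + y)) ->
  'D_v F x = 'D_w H y /\ derivable F x v = derivable H y w.
Proof.
move=> E; have E0 : F x = H y by have := E 0; rewrite !scale0r !add0r.
have Q : (fun h : R => h^-1 *: ((F \o shift x) (h *: v) - F x)) =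
         (fun h : R => h^-1 *: ((H \o shift y) (h *: w) - H y)).
  by apply/funext => h /=; rewrite E E0.
by rewrite /derive /derivable Q.
Qed.

Section Game_calculus.
Context {R : realType} {d : measure_display} {T : measurableType d}
  {P : probability T R} (G : sgame P).
Local Notation player := 'I_(nplayers G).
Implicit Types (i j : player) (x y : profile G) (g : profile G -> R).

Lemma blkD x y i : blk (x + y) i = blk x i + blk y i.
Proof. exact: submxrowD. Qed.

Lemma blkB x y i : blk (x - y) i = blk x i - blk y i.
Proof. exact: submxrowB. Qed.

Lemma blkZ (k : R) x i : blk (k *: x) i = k *: blk x i.
Proof. by apply/rowP => c; rewrite !mxE. Qed.

Lemma blk0 i : blk (0 : profile G) i = 0.
Proof. by apply/rowP => c; rewrite !mxE. Qed.

Lemma profileP x y : (forall i, blk x i = blk y i) -> x = y.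
Proof. by move/mxrowP. Qed.

Lemma blk_repl x i (z : 'rV[R]_(sdim i)) : blk (repl x z) i = z.
Proof. by rewrite /blk /repl mxrowK dfwithin. Qed.

Lemma blk_repl_neq x i j (z : 'rV[R]_(sdim i)) : j != i -> blk (repl x z) j = blk x j.
Proof. by move=> ji; rewrite /blk /repl mxrowK dfwithout// eq_sym. Qed.

Lemma repl_blk x i : repl x (blk x i) = x.
Proof.
by apply: profileP => j; have [->|ji] := eqVneq j i; rewrite ?blk_repl// blk_repl_neq.
Qed.

Lemma repl_repl x i (z z' : 'rV[R]_(sdim i)) : repl (repl x z) z' = repl x z'.
Proof.
by apply: profileP => j; have [->|ji] := eqVneq j i; rewrite ?blk_repl// !blk_repl_neq.
Qed.

Lemma replD x i (z v : 'rV[R]_(sdim i)) : repl x (z + v) = repl x z + repl 0 v.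
Proof.
apply: profileP => j; have [->|ji] := eqVneq j i; rewrite blkD ?blk_repl//.
by rewrite !blk_repl_neq// blk0 addr0.
Qed.

Lemma repl0Z (k : R) i (v : 'rV[R]_(sdim i)) : repl (0 : profile G) (k *: v) = k *: repl 0 v.
Proof.
apply: profileP => j; have [->|ji] := eqVneq j i; rewrite blkZ ?blk_repl//.
by rewrite !blk_repl_neq// blk0 scaler0.
Qed.

Lemma feasible_repl x i (z : 'rV[R]_(sdim i)) :
  rivals_feasible i x -> strat z -> feasible (repl x z).
Proof.
move=> fx sz j; have [->|ji] := eqVneq j i; first by rewrite blk_repl.
by rewrite blk_repl_neq//; exact: fx.
Qed.

Lemma feasible_rivals x i : feasible x -> rivals_feasible i x.
Proof. by move=> fx j _; exact: fx. Qed.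

Lemma repl0_delta i (c : 'I_(sdim i)) :
  repl 0 (delta_mx 0 c) = delta_mx 0 (tagnat.Rank i c) :> profile G.
Proof.
apply: profileP => j; apply/rowP => b; rewrite ![RHS]mxE /=.
have [E|E] := eqVneq (tagnat.Rank j b) (tagnat.Rank i c).
  have ji : j = i by rewrite -(tagnat.Rank1K b) E tagnat.Rank1K.
  subst j; have -> : b = c.
    have /(can_inj (@tagnat.rankK _ _))/eqP := E; rewrite -tag_eqE /tag_eq/= eqxx/=.
    by rewrite tagged_asE => /eqP.
  by rewrite blk_repl mxE !eqxx.
rewrite ?andbF ?andFb; have [ji|ji] := eqVneq j i; last by rewrite blk_repl_neq// blk0 mxE.
subst j; rewrite blk_repl mxE eqxx/=; case: eqP => // bc; by rewrite bc eqxx in E.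
Qed.

Lemma derive_repl i x g (z v : 'rV[R]_(sdim i)) :
  'D_v (fun z' => g (repl x z')) z = 'D_(repl 0 v) g (repl x z).
Proof.
apply: (proj1 (derive_congr _)) => h.
by rewrite [h *: v + z]addrC replD repl0Z [_ + repl x z]addrC.
Qed.

(** Makes the differentiability of the full gradient, which is what twice differentiability
    provides, available for partial gradients. *)
Lemma pgradE i g x : pgrad i g x = blk (grad g x) i.
Proof.
by apply/rowP => c; rewrite [LHS]mxE derive_repl repl_blk repl0_delta [RHS]mxE [RHS]mxE.
Qed.

Lemma pgrad_repl i g x (z : 'rV[R]_(sdim i)) :
  pgrad i g (repl x z) = grad (fun z' => g (repl x z')) z.
Proof.
rewrite /pgrad blk_repl; congr (grad _ z).
by apply/funext => z'; rewrite repl_repl.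
Qed.

Lemma derive_pgrad i g x (r : profile G) (b : 'I_(sdim i)) :
  differentiable (grad g) x ->
  is_derive x r (fun y => pgrad i g y 0 b) ((\sum_j blk r j *m (hess i j g x)^T) 0 b).
Proof.
move=> dg.
have dgb : differentiable (fun y => pgrad i g y 0 b) x.
  rewrite (_ : (fun y => _) = (fun y : 'rV[R]__ => y 0 (tagnat.Rank i b)) \o grad g).
    by apply: differentiable_comp => //; exact: differentiable_coord.
  by apply/funext => y /=; rewrite pgradE !mxE.
apply: DeriveDef; first exact: diff_derivable.
rewrite deriveE_grad// dotv_blocks summxE; apply: eq_bigr => j _.
rewrite mulmx_dotv dotvC; congr dotv; apply/rowP => c.
transitivity (blk (grad (fun y => pgrad i g y 0 b) x) j 0 c) => //.
by rewrite -pgradE [RHS]mxE [RHS]mxE.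
Qed.

End Game_calculus.

(** * Mean value theorem along a segment *)

Section Line.
Context {R : realType} {V : normedModType R}.

Lemma derive_line (F : V -> R) (p r : V) (t : R) :
  'D_1 (fun s : R => F (p + s *: r)) t = 'D_r F (p + t *: r).
Proof.
apply: (proj1 (derive_congr _)) => h.
by rewrite scalerDl [h%:A]mulr1 addrCA.
Qed.

Lemma derivable_line (F : V -> R) (p r : V) (t : R) :
  derivable F (p + t *: r) r -> derivable (fun s : R => F (p + s *: r)) t 1.
Proof.
suff -> : derivable (fun s : R => F (p + s *: r)) t 1 = derivable F (p + t *: r) r by [].
apply: (proj2 (derive_congr _)) => h.
by rewrite scalerDl [h%:A]mulr1 addrCA.
Qed.

Lemma mean_value_line (F dF : V -> R) (p r : V) :
  (forall t, 0 <= t <= 1 -> is_derive (p + t *: r) r F (dF (p + t *: r))) ->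
  exists2 t, 0 <= t <= 1 & F (p + r) - F p = dF (p + t *: r).
Proof.
move=> H; pose h s := F (p + s *: r).
have dh (t : R) : 0 <= t <= 1 -> is_derive t 1 h (dF (p + t *: r)).
  move=> /H[dF1 dF2]; apply: DeriveDef; first exact: derivable_line.
  by rewrite derive_line dF2.
have [t||t tt] := @MVT_segment R h (fun t => dF (p + t *: r)) 0 1 ler01.
- by rewrite in_itv/= => /andP[t0 t1]; apply: dh; rewrite !ltW.
- apply: derivable_within_continuous => t; rewrite in_itv/= => /dh[].
  by [].
rewrite /h scale1r scale0r addr0 subr0 mulr1 => E.
by exists t => //; move: tt; rewrite in_itv.
Qed.

End Line.

(** * The proximal best response *)

(** With [w = p' - p], the two inequalities add up to [dotv (g' - g) w + mu |w|^2 <= mu * dotv (b' -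
    b) w]. Here [ze] stands for the curvature in the player's own block and [S] for the effect of
    the rivals' moves. *)
Lemma perturbed_vi (R : realType) (n : nat) (mu ze S : R) (g g' p p' b b' : 'rV[R]_n) :
  0 < mu ->
  0 <= dotv (g + mu *: (p - b)) (p' - p) ->
  0 <= dotv (g' + mu *: (p' - b')) (p - p') ->
  ze * enorm (p' - p) ^+ 2 - S <= dotv g' (p' - p) - dotv g (p' - p) ->
  (mu + ze) * enorm (p' - p) ^+ 2 <= mu * (enorm (p' - p) * enorm (b - b')) + S.
Proof.
move=> mu0.
set e := enorm (p' - p) * enorm (b - b').
have dw : enorm (p' - p) ^+ 2 = dotv p' (p' - p) - dotv p (p' - p) by rewrite enorm_sq dotvBl.
have : dotv b' (p' - p) - dotv b (p' - p) <= e.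
  by rewrite -dotvBl /e; apply: le_trans (cauchy_schwarz _ _) _; rewrite mulrC (enormB b').
rewrite -(ler_pM2l mu0) dw -[p - p']opprB dotvNr.
move: e (p' - p) => e w.
by rewrite (dotvDl g) (dotvDl g') !dotvZl !dotvBl; lra.
Qed.

Section Prox_response.
Context {R : realType} {d : measure_display} {T : measurableType d}
  {P : probability T R} (G : sgame P).
Local Notation player := 'I_(nplayers G).
Context (M : player -> R) (HA : assumptionA M) (mu : R) (mu0 : 0 < mu).
Implicit Types (i j : player) (x y : profile G).

Lemma strat_compact i : compact (strat (i := i)).
Proof. by have [[_ ? _] _ _ _] := HA i. Qed.

Lemma strat_convex i : convex_set (strat (i := i)).
Proof. by have [[_ _ ?] _ _ _] := HA i. Qed.

Lemma feasible_segment x y (t : R) : feasible x -> feasible y -> 0 <= t <= 1 ->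
  feasible (x + t *: (y - x)).
Proof.
move=> fx fy t01 i; rewrite blkD blkZ blkB.
by apply: convex_set_segment => //; exact: strat_convex.
Qed.

Lemma differentiable_grad_f i x : feasible x -> differentiable (grad (f i)) x.
Proof. by move=> fx; have [_ [_ /(_ x fx)[]]] := HA i. Qed.

Lemma differentiable_f_repl i x (z : 'rV[R]_(sdim i)) :
  rivals_feasible i x -> strat z -> differentiable (fun z => f i (repl x z)) z.
Proof.
move=> fx sz; have [_ [/(_ x fx)[U [_ _ sU _ cU]] _] _ _] := HA i.
by have [] := cU z (sU _ sz).
Qed.

Lemma pgrad_f_monotone i x (z z' : 'rV[R]_(sdim i)) :
  rivals_feasible i x -> strat z -> strat z' ->
  0 <= dotv (pgrad i (f i) (repl x z) - pgrad i (f i) (repl x z')) (z - z').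
Proof.
move=> fx sz sz'; have [_ [/(_ x fx)[U [_ _ sU vU cU]] _] _ _] := HA i.
rewrite !pgrad_repl.
by apply: (convex_grad_monotone vU); [exact: sU..|exact: differentiable_f_repl|exact: differentiable_f_repl].
Qed.

(** Pairing with a fixed [w] makes the gradient field scalar, as the mean value theorem requires. *)
Lemma derive_dotv_pgrad i x (r : profile G) (w : 'rV[R]_(sdim i)) : feasible x ->
  is_derive x r (fun y => dotv (pgrad i (f i) y) w)
    (dotv (\sum_j blk r j *m (hess i j (f i) x)^T) w).
Proof.
move=> fx.
have dg (b : 'I_(sdim i)) := derive_pgrad r b (differentiable_grad_f i fx).
have -> : (fun y => dotv (pgrad i (f i) y) w) =
    \sum_b (fun y => w 0 b *: (pgrad i (f i) y 0 b : R^o)).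
  by apply/funext => y; rewrite fct_sumE; apply: eq_bigr => b _; rewrite mulrC.
have dgb b : is_derive x r (fun y => w 0 b *: (pgrad i (f i) y 0 b : R^o))
   (w 0 b *: ((\sum_j blk r j *m (hess i j (f i) x)^T) 0 b : R^o)).
  have [D1 D2] := dg b.
  apply: DeriveDef; first exact: (@derivableZ _ _ _ (fun y => pgrad i (f i) y 0 b)).
  by rewrite (@deriveZ _ _ _ (fun y => pgrad i (f i) y 0 b))// D2.
apply: is_derive_eq.
by apply: eq_bigr => b _; rewrite [LHS]mulrC.
Qed.

(** The quadratic form is the limit of difference quotients of the partial gradient along [v], which
    are nonnegative because the gradient of a convex function is monotone. *)
Lemma hess_psd i x (v : 'rV[R]_(sdim i)) : feasible x ->
  0 <= dotv v (v *m (hess i i (f i) x)^T).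
Proof.
move=> fx; have fxi := feasible_rivals fx (i := i).
have [_ [/(_ x fxi)[U [oU _ sU vU cU]] _] _ _] := HA i.
have [D1 D2] := derive_dotv_pgrad (repl 0 v) v fx.
have -> : dotv v (v *m (hess i i (f i) x)^T) =
    'D_(repl 0 v) (fun y => dotv (pgrad i (f i) y) v) x.
  rewrite D2 (bigD1 i)//= blk_repl [X in _ + X]big1 ?addr0 1?dotvC// => j ji.
  by rewrite blk_repl_neq// blk0 mul0mx.
apply: (cvgr_to_ge (cvg_dnbhs_at_right D1)).
have Ux : U (blk x i) by apply: sU; exact: fx.
(* The block may lie on the boundary of the strategy set, and [v] may point outwards; the open set
   [U] on which convexity holds leaves room for small steps. *)
have nU : \forall t \near 0^'+, U (blk x i + t *: v).
  have ct : blk x i + t *: v @[t --> 0^'+] --> blk x i + 0 *: v.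
    apply: cvg_at_right_filter; apply: cvgD; first exact: cvg_cst.
    by apply: cvgZr_tmp; exact: cvg_id.
  by apply: ct; rewrite scale0r addr0; exact: open_nbhs_nbhs.
near=> t.
have t0 : 0 < t by near: t; exact: nbhs_right_gt.
have Ut : U (blk x i + t *: v) by near: t.
rewrite /= /GRing.scale/= mulr_ge0 ?invr_ge0 ?(ltW t0)//.
have -> : t *: repl 0 v + x = repl x (blk x i + t *: v) by rewrite replD repl_blk repl0Z addrC.
have -> : pgrad i (f i) x = pgrad i (f i) (repl x (blk x i)) by rewrite repl_blk.
rewrite -dotvBl -(pmulr_rge0 _ t0) -dotvZr !pgrad_repl; set z := blk x i + _ in Ut *.
have <- : z - blk x i = t *: v by rewrite /z addrC addKr.
by apply: (convex_grad_monotone vU) => //; [have [] := cU _ Ut|have [] := cU _ Ux].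
Unshelve. all: by end_near. Qed.

Lemma zeta_min_ge0 i x : feasible x -> 0 <= zeta_min i.
Proof.
move=> fx; apply: lb_le_inf; first by exists (lambda_min (hess i i (f i) x)); exists x.
by move=> _ [y fy <-]; apply: lambda_min_ge0 => v; exact: hess_psd.
Qed.

Lemma zeta_min_quadratic i x (v : 'rV[R]_(sdim i)) : feasible x ->
  zeta_min i * enorm v ^+ 2 <= dotv v (v *m (hess i i (f i) x)^T).
Proof.
move=> fx; have psd v' := hess_psd v' fx (i := i).
apply: le_trans (lambda_min_quadratic v psd); rewrite ler_wpM2r ?sqr_ge0//.
apply: ge_inf; last by exists x.
by exists 0 => _ [y fy <-]; apply: lambda_min_ge0 => w; exact: hess_psd.
Qed.

Lemma mu_zeta_gt0 i x : feasible x -> 0 < mu + zeta_min i.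
Proof. by move=> fx; rewrite ltr_wpDr// (zeta_min_ge0 i fx). Qed.

(** First-order condition shared by the proximal best response to [y] and by the equilibrium (with
    [y = xs]), so that one contraction lemma compares either kind of point. *)
Definition vi_solution (y : profile G) i (p : 'rV[R]_(sdim i)) : Prop :=
  strat p /\ forall z, strat z ->
    0 <= dotv (pgrad i (f i) (repl y p) + mu *: (p - blk y i)) (z - p).

Lemma minimizer_vi_solution y i (p : 'rV[R]_(sdim i)) :
  rivals_feasible i y -> strat p ->
  (forall z, strat z -> f i (repl y p) + mu / 2 * enorm (p - blk y i) ^+ 2
     <= f i (repl y z) + mu / 2 * enorm (z - blk y i) ^+ 2) ->
  vi_solution y p.
Proof.
move=> fy sp Hp; split => // z sz; rewrite pgrad_repl.
apply: (prox_variational (A := strat (i := i))) => //; first exact: strat_convex.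
exact: differentiable_f_repl.
Qed.

Lemma prox_br_spec y i : feasible y ->
  strat (prox_br mu y i) /\ forall z, strat z ->
    f i (repl y (prox_br mu y i)) + mu / 2 * enorm (prox_br mu y i - blk y i) ^+ 2
     <= f i (repl y z) + mu / 2 * enorm (z - blk y i) ^+ 2.
Proof.
move=> fy; have fyi := feasible_rivals fy (i := i).
pose obj (z : 'rV[R]_(sdim i)) := f i (repl y z) + mu / 2 * enorm (z - blk y i) ^+ 2.
apply: (@xgetPex _ _ [set z | strat z /\ forall z', strat z' -> obj z <= obj z']).
have [||p /set_mem Ap Hp] := @EVT_min_rV R _ obj (strat (i := i)) _ (@strat_compact i).
- by exists (blk y i); exact: fy.
- rewrite continuous_subspace_in => z /set_mem sz; apply: continuous_subspaceT_for.
  + by [].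
  apply: (@continuousD R _ _ (fun z => f i (repl y z))
    (fun z => mu / 2 * enorm (z - blk y i) ^+ 2)).
    exact: (differentiable_continuous (differentiable_f_repl fyi sz)).
  apply: (@continuousM R 'rV[R]_(sdim i) (cst (mu / 2)) (fun z => enorm (z - blk y i) ^+ 2) z).
    exact: cst_continuous.
  apply: (@continuous_comp _ _ _ (fun z : 'rV[R]_(sdim i) => enorm (z - blk y i)) (fun u : R => u ^+ 2) z);
    last exact: exprn_continuous.
  apply: (@continuous_comp _ _ _ (fun z : 'rV[R]_(sdim i) => z - blk y i) (@enorm R _) z);
    last exact: continuous_enorm.
  by apply: (@continuousB R _ _ id (cst (blk y i)) z); [exact: cvg_id|exact: cst_continuous].
by exists p; split => // z Az; apply: Hp; rewrite inE.
Qed.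

Lemma prox_br_strat y i : feasible y -> strat (prox_br mu y i).
Proof. by case/(prox_br_spec i). Qed.

Lemma prox_br_vi y i : feasible y -> vi_solution y (prox_br mu y i).
Proof.
move=> fy; have [sp Hp] := prox_br_spec i fy.
by apply: minimizer_vi_solution => //; exact: feasible_rivals.
Qed.

(** The fixed point property: the quadratic term vanishes at [blk xs i] and is nonnegative
    elsewhere, so the equilibrium block also minimizes the proximal objective centred at itself. *)
Lemma nash_vi xs i : nash xs -> vi_solution xs (blk xs i).
Proof.
move=> [fx Hx]; apply: minimizer_vi_solution; [exact: feasible_rivals|exact: fx|].
move=> z sz; rewrite subrr enorm0 expr0n/= mulr0 addr0 repl_blk.
by apply: le_trans (Hx i z sz) _; rewrite lerDl mulr_ge0 ?sqr_ge0// divr_ge0// ltW.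
Qed.

(** * Contraction of the proximal best response *)

Section Contraction.
Context (bounded_cross : forall i j, j != i -> has_ubound (cross_hess_norms i j)).

Lemma specnorm_le_zeta_max i j x : feasible x -> j != i ->
  specnorm (hess i j (f i) x) <= zeta_max i j.
Proof.
move=> fx ji; apply: ub_le_sup; first exact: bounded_cross.
by exists x.
Qed.

Lemma zeta_max_ge0 i j x : feasible x -> j != i -> 0 <= zeta_max i j.
Proof. by move=> fx ji; apply: le_trans (specnorm_le_zeta_max fx ji); exact: specnorm_ge0. Qed.

Lemma Gamma_ge0 i j x : feasible x -> 0 <= Gamma G mu i j.
Proof.
move=> fx; rewrite mxE divr_ge0 ?(ltW (mu_zeta_gt0 i fx))//.
by case: eqVneq => [_|ij]; [exact: ltW|apply: (zeta_max_ge0 fx); rewrite eq_sym].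
Qed.

(** The segment joins [repl y p] to [repl y' p']: its own block is [w = p' - p], its other blocks
    are the rivals' moves. The diagonal Hessian block contributes [zeta_min], the cross blocks
    [zeta_max], and dividing by [mu + zeta_min i] produces row [i] of [Gamma]. *)
Lemma vi_solution_contraction i y y' (p p' : 'rV[R]_(sdim i)) :
  feasible y -> feasible y' -> vi_solution y p -> vi_solution y' p' ->
  enorm (p - p') <= \sum_j Gamma G mu i j * enorm (blk y j - blk y' j).
Proof.
move=> fy fy' [sp Hp] [sp' Hp'].
have z0 := mu_zeta_gt0 i fy.
set w := p' - p; set P0 := repl y p; set P1 := repl y' p'.
have f0 : feasible P0 by apply: feasible_repl => //; exact: feasible_rivals.
have f1 : feasible P1 by apply: feasible_repl => //; exact: feasible_rivals.
pose r := P1 - P0.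
have ri : blk r i = w by rewrite blkB !blk_repl.
have rj j : j != i -> enorm (blk r j) = enorm (blk y j - blk y' j).
  by move=> ji; rewrite blkB !blk_repl_neq// enormB.
have [t t01] := mean_value_line (F := fun y => dotv (pgrad i (f i) y) w)
  (dF := fun y => dotv (\sum_j blk r j *m (hess i j (f i) y)^T) w)
  (p := P0) (r := r) (fun t t01 => derive_dotv_pgrad r w (feasible_segment f0 f1 t01)).
have -> : P0 + r = P1 by rewrite addrC subrK.
set Y := P0 + t *: r => E.
have fY : feasible Y by exact: feasible_segment.
have H1 := Hp _ sp'; have H2 := Hp' _ sp.
have lower : zeta_min i * enorm w ^+ 2 -
    \sum_(j | j != i) zeta_max i j * enorm w * enorm (blk y j - blk y' j) <=
    dotv (pgrad i (f i) P1) w - dotv (pgrad i (f i) P0) w.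
  have {}E : dotv (pgrad i (f i) P1) w - dotv (pgrad i (f i) P0) w =
      dotv w (w *m (hess i i (f i) Y)^T) +
      \sum_(j | j != i) dotv w (blk r j *m (hess i j (f i) Y)^T).
    rewrite E (big_morph (fun u => dotv u w) (fun u v => dotvDl u v w) (dotv0l w)).
    by rewrite (bigD1 i)//= ri dotvC; congr (_ + _); apply: eq_bigr => j _; rewrite dotvC.
  rewrite E lerD ?zeta_min_quadratic// lerNl -sumrN.
  apply: ler_sum => j ji; rewrite -rj//.
  apply: le_trans (ler_norm _) _; rewrite normrN; apply: le_trans (specnorm_dotv_le _ _ _) _.
  by rewrite !ler_wpM2r ?enorm_ge0// specnorm_le_zeta_max.
have main : (mu + zeta_min i) * enorm w ^+ 2 <=
    enorm w * \sum_j (if i == j then mu else zeta_max i j) * enorm (blk y j - blk y' j).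
  rewrite (bigD1 i)//= eqxx mulrDr mulr_sumr.
  have -> : \sum_(j | j != i) enorm w *
      ((if i == j then mu else zeta_max i j) * enorm (blk y j - blk y' j)) =
    \sum_(j | j != i) zeta_max i j * enorm w * enorm (blk y j - blk y' j).
    by apply: eq_bigr => j ji; rewrite eq_sym (negbTE ji) mulrCA mulrA.
  by rewrite [enorm w * (mu * _)]mulrCA; exact: perturbed_vi mu0 H1 H2 lower.
(* [main] carries a factor [enorm w] on both sides, which has to be cancelled. *)
have [w0|w0] := eqVneq (enorm w) 0.
  rewrite enormB -/w w0; apply: sumr_ge0 => j _.
  by rewrite mulr_ge0 ?enorm_ge0// (Gamma_ge0 i j fy).
have wp : 0 < enorm w by rewrite lt_neqAle eq_sym w0 enorm_ge0.
rewrite enormB -/w -(ler_pM2l z0) -(ler_pM2l wp).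
apply: le_trans (le_trans _ main) _; first by rewrite expr2 mulrCA.
rewrite ler_pM2l// mulr_sumr; apply: ler_sum => j _.
by rewrite mxE mulrA [(mu + _) * _]mulrC divfK// gt_eqF.
Qed.

Lemma prox_br_contraction i y y' : feasible y -> feasible y' ->
  enorm (prox_br mu y i - prox_br mu y' i) <=
    \sum_j Gamma G mu i j * enorm (blk y j - blk y' j).
Proof. by move=> fy fy'; apply: vi_solution_contraction => //; exact: prox_br_vi. Qed.

Lemma prox_br_nash xs i y : nash xs -> feasible y ->
  enorm (prox_br mu y i - blk xs i) <= \sum_j Gamma G mu i j * enorm (blk y j - blk xs j).
Proof.
move=> nx fy; apply: vi_solution_contraction => //; first by case: nx.
  exact: prox_br_vi.
exact: nash_vi.
Qed.

Lemma specnorm_Gamma_gt0 x : (0 < nplayers G)%N -> feasible x -> 0 < specnorm (Gamma G mu).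
Proof.
move=> N0 fx; pose i := Ordinal N0.
apply: lt_le_trans (abs_entry_le_specnorm _ i i); rewrite mxE eqxx normr_gt0 gt_eqF//.
by rewrite divr_gt0// (mu_zeta_gt0 i fx).
Qed.

End Contraction.
End Prox_response.

(** * Measurability of continuous functions of random vectors *)

Section Measurable_rows.
Context {R : realType} {d : measure_display} {T : measurableType d}.

Definition measurable_row (n : nat) (X : T -> 'rV[R]_n) : Prop :=
  forall c, measurable_fun setT (fun w => X w 0 c).

(* Rounding the coordinates to multiples of 1/(k+1) gives countably valued
   approximations of [X]. *)
Lemma measurable_continuous_row (n : nat) (X : T -> 'rV[R]_n) (phi : 'rV[R]_n -> R) :
  measurable_row X -> continuous phi -> measurable_fun setT (phi \o X).
Proof.
move=> mX cphi.
pose V k w : 'rV[int]_n := \row_c Num.floor (k.+1%:R * X w 0 c).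
pose rnd k (v : 'rV[int]_n) : 'rV[R]_n := \row_c ((v 0 c)%:~R / k.+1%:R).
apply: (@measurable_fun_cvg _ _ _ _ (fun k w => phi (rnd k (V k w)))).
  move=> k _ B mB; rewrite setTI.
  have -> : (fun w => phi (rnd k (V k w))) @^-1` B =
      \bigcup_(v : 'rV[int]_n) ((V k @^-1` [set v]) `&` [set w | B (phi (rnd k v))]).
    apply/seteqP; split => w /=; first by move=> Bw; exists (V k w).
    by case=> v _ [<-].
  apply: countable_bigcupT_measurable; first exact: countableP.
  move=> v; apply: measurableI; last first.
    have [Bv|Bv] := pselect (B (phi (rnd k v))).
      by rewrite (_ : [set _ | _] = setT)//; apply/seteqP; split.
    by rewrite (_ : [set _ | _] = set0)//; apply/seteqP; split.
  have -> : V k @^-1` [set v] =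
      \bigcap_(c in [set: 'I_n]) ((fun w => k.+1%:R * X w 0 c) @^-1`
        `[(v 0 c)%:~R, (v 0 c + 1)%:~R[%classic).
    apply/seteqP; split => w /=.
      by move=> Vv c _ /=; rewrite in_itv/= -floor_eq -Vv mxE.
    move=> H; apply/rowP => c; rewrite mxE; apply/eqP; rewrite floor_eq.
    by have := H c Logic.I; rewrite /= in_itv.
  apply: fin_bigcap_measurable; first exact: finite_finset.
  move=> c _; rewrite -[X in measurable X]setTI.
  apply: measurable_funM; [exact: measurable_cst|exact: mX|by []|exact: measurable_itv].
move=> w _.
apply: (@cvg_comp _ _ _ (fun k => rnd k (V k w)) phi _ (nbhs (X w))); last exact: cphi.
apply/cvgrPdist_le => e e0; near=> k.
rewrite /Num.norm/= mx_normrE; apply/bigmax_leP; split => /=; first exact: ltW.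
move=> [i c] _ /=; rewrite !mxE (ord1 i).
have k0 : 0 < k.+1%:R :> R by rewrite ltr0n.
rewrite -[X in X - _](mulfK (lt0r_neq0 k0)) -mulrBl normrM normfV [`|k.+1%:R|]ger0_norm ?(ltW k0)//.
rewrite ler_pdivrMr//; apply: (@le_trans _ _ 1).
  rewrite [X w 0 c * _]mulrC ger0_norm ?subr_ge0 ?floor_le// lerBlDr addrC.
  by rewrite ltW// (lt_le_trans (floorD1_gt _))// intrD.
rewrite mulrC -ler_pdivrMr// mul1r; near: k.
by exists (Num.truncn e^-1) => // k /= kN; rewrite ltW// (lt_le_trans (truncnS_gt _))// ler_nat.
Unshelve. all: by end_near. Qed.

Lemma measurable_row_comp (n m : nat) (X : T -> 'rV[R]_n) (phi : 'rV[R]_n -> 'rV[R]_m) :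
  measurable_row X -> continuous phi -> measurable_row (phi \o X).
Proof.
move=> mX cphi c.
apply: (@measurable_continuous_row _ X (fun x => phi x 0 c)) => // x.
by apply: (@continuous_comp _ _ _ phi (fun u : 'rV[R]_m => u 0 c) x); [exact: cphi|exact: coord_continuous].
Qed.

Lemma measurable_rowD (n : nat) (X Y : T -> 'rV[R]_n) :
  measurable_row X -> measurable_row Y -> measurable_row (fun w => X w + Y w).
Proof.
move=> mX mY c; under eq_fun do rewrite mxE.
by apply: measurable_funD; [exact: mX|exact: mY].
Qed.

Lemma measurable_rowZ (n : nat) (k : R) (X : T -> 'rV[R]_n) :
  measurable_row X -> measurable_row (fun w => k *: X w).
Proof.
move=> mX c; under eq_fun do rewrite mxE.
by apply: measurable_funM; [exact: measurable_cst|exact: mX].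
Qed.

Lemma measurable_rowB (n : nat) (X Y : T -> 'rV[R]_n) :
  measurable_row X -> measurable_row Y -> measurable_row (fun w => X w - Y w).
Proof.
move=> mX mY c; under eq_fun do rewrite !mxE.
by apply: measurable_funB; [exact: mX|exact: mY].
Qed.

Lemma measurable_enorm (n : nat) (X : T -> 'rV[R]_n) :
  measurable_row X -> measurable_fun setT (fun w => enorm (X w)).
Proof. by move=> mX; apply: (measurable_continuous_row mX); exact: continuous_enorm. Qed.

End Measurable_rows.

Lemma lipschitz_enorm_continuous (R : realType) (n m : nat) (L : R) (phi : 'rV[R]_n -> 'rV[R]_m) :
  (forall x y, enorm (phi x - phi y) <= L * enorm (x - y)) -> continuous phi.
Proof.
move=> H x; apply: (iffRL (@cvgrPdist_le R _ _ (nbhs x) (nbhs_filter x) phi (phi x))) => e e0.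
have L1 : 0 < `|L| + 1 by rewrite ltr_wpDl.
have n1 : 0 < n%:R + 1 :> R by rewrite ltr_wpDl.
near=> y.
apply: le_trans (norm_le_enorm _) _; apply: le_trans (H _ _) _.
have Lxy : L * enorm (x - y) <= (`|L| + 1) * enorm (x - y).
  by rewrite ler_wpM2r ?enorm_ge0// (le_trans (ler_norm _))// lerDl.
apply: (le_trans Lxy); apply: (@le_trans _ _ ((`|L| + 1) * ((n%:R + 1) * `|x - y|))).
  rewrite ler_pM2l//; apply: le_trans (enorm_le_norm _) _.
  by rewrite ler_wpM2r// lerDl.
rewrite mulrA mulrC -ler_pdivlMr ?mulr_gt0//.
near: y; apply: (@cvgr_dist_le R _ _ (nbhs x) (nbhs_filter x) id x); first exact: cvg_id.
by rewrite divr_gt0// mulr_gt0.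
Unshelve. all: by end_near. Qed.

(** * Measurability of the iterates *)

Section Game_measurability.
Context {R : realType} {d : measure_display} {T : measurableType d}
  {P : probability T R} (G : sgame P).
Local Notation player := 'I_(nplayers G).
Context (M : player -> R) (HA : assumptionA M) (wpG : well_posed G)
  (mu : R) (mu0 : 0 < mu)
  (bounded_cross : forall i j : player, j != i -> has_ubound (cross_hess_norms i j))
  (x_ : profile G) (fx_ : feasible x_).
Implicit Types (i j : player) (x y : profile G).

Lemma enorm_profile_sq x : enorm x ^+ 2 = \sum_i enorm (blk x i) ^+ 2.
Proof. by rewrite enorm_sq dotv_blocks; apply: eq_bigr => i _; rewrite enorm_sq. Qed.

Lemma enorm_blk_le x i : enorm (blk x i) <= enorm x.
Proof.
rewrite -(ler_pXn2r (n := 2)) ?nnegrE ?enorm_ge0// enorm_profile_sq (bigD1 i)//=.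
by rewrite lerDl sumr_ge0// => j _; exact: sqr_ge0.
Qed.

Definition profile_proj x : profile G := \mxrow_i proj (strat (i := i)) (blk x i).

Lemma blk_profile_proj x i : blk (profile_proj x) i = proj (strat (i := i)) (blk x i).
Proof. by rewrite /blk /profile_proj mxrowK. Qed.

Lemma strat_nonempty i : (strat (i := i)) !=set0.
Proof. by exists (blk x_ i); exact: fx_. Qed.

Lemma feasible_profile_proj x : feasible (profile_proj x).
Proof.
move=> i; rewrite blk_profile_proj.
by have [] := proj_spec (blk x i) (strat_compact HA (i := i)) (strat_nonempty i).
Qed.

Lemma profile_proj_id x : feasible x -> profile_proj x = x.
Proof.
move=> fx; apply: profileP => i; rewrite blk_profile_proj proj_id//.
exact: strat_compact HA _.
Qed.

Lemma profile_proj_nonexpansive x y :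
  enorm (profile_proj x - profile_proj y) <= enorm (x - y).
Proof.
rewrite -(ler_pXn2r (n := 2)) ?nnegrE ?enorm_ge0// !enorm_profile_sq.
apply: ler_sum => i _; rewrite ler_pXn2r ?nnegrE ?enorm_ge0// !blkB !blk_profile_proj.
apply: proj_nonexpansive; [exact: strat_compact HA _|exact: strat_convex HA _|exact: strat_nonempty].
Qed.

Lemma continuous_profile_proj : continuous profile_proj.
Proof.
apply: (@lipschitz_enorm_continuous _ _ _ 1) => x y.
by rewrite mul1r; exact: profile_proj_nonexpansive.
Qed.

(** The contraction estimate holds between feasible profiles; projecting first makes the map
    Lipschitz on the whole space, without changing it at feasible points. *)
Lemma continuous_prox_br i : continuous (fun x => prox_br mu (profile_proj x) i).
Proof.
apply: (@lipschitz_enorm_continuous _ _ _ (\sum_j Gamma G mu i j)) => x y.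
apply: le_trans (prox_br_contraction HA mu0 bounded_cross i
  (feasible_profile_proj x) (feasible_profile_proj y)) _.
rewrite mulr_suml; apply: ler_sum => j _; rewrite ler_wpM2l ?(Gamma_ge0 HA mu0 bounded_cross i j fx_)//.
rewrite -blkB; apply: le_trans (enorm_blk_le _ _) _; exact: profile_proj_nonexpansive.
Qed.

(** Feasible profiles form the zero set of the distance to [profile_proj], a continuous function of
    the profile. *)
Lemma measurable_feasible :
  measurable [set u : (\sum_j sdim (s := G) j)%N.-tuple R | feasible (\row_b tnth u b : profile G)].
Proof.
set n := (\sum_j sdim j)%N.
have mrow : measurable_row (fun u : n.-tuple R => \row_b tnth u b).
  by move=> c; under eq_fun do rewrite mxE; exact: measurable_tnth.
have mg : measurable_fun setT
    (fun u : n.-tuple R => enorm (profile_proj (\row_b tnth u b) - (\row_b tnth u b : profile G))).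
  apply: measurable_enorm; apply: measurable_rowB => //.
  by apply: measurable_row_comp => //; exact: continuous_profile_proj.
rewrite (_ : [set u | _] = (fun u : n.-tuple R =>
    enorm (profile_proj (\row_b tnth u b) - (\row_b tnth u b : profile G))) @^-1` [set 0]).
  by rewrite -[X in measurable X]setTI; apply: mg => //; exact: measurable_set1.
apply/seteqP; split => u /=; first by move=> fu; rewrite profile_proj_id// subrr enorm0.
by move=> /enorm_eq0/eqP; rewrite subr_eq0 => /eqP <-; exact: feasible_profile_proj.
Qed.

Section Measurable_maps.
Context {d' : measure_display} {T' : measurableType d'}.

Lemma measurable_blk (X : T' -> profile G) i :
  measurable_row X -> measurable_row (fun w => blk (X w) i).
Proof. by move=> mX c; under eq_fun do rewrite mxE; exact: mX. Qed.

Lemma measurable_profile (X : T' -> profile G) :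
  (forall i, measurable_row (fun w => blk (X w) i)) -> measurable_row X.
Proof.
move=> mX c; rewrite -(tagnat.sig2K c).
have := mX (tagnat.sig1 c) (tagnat.sig2 c); congr measurable_fun.
by apply/funext => w; rewrite mxE.
Qed.

Lemma measurable_repl (X : T' -> profile G) i (Z : T' -> 'rV[R]_(sdim i)) :
  measurable_row X -> measurable_row Z -> measurable_row (fun w => repl (X w) (Z w)).
Proof.
move=> mX mZ; apply: measurable_profile => j; have [->|ji] := eqVneq j i.
  by under eq_fun do rewrite blk_repl.
by under eq_fun do rewrite blk_repl_neq//; exact: measurable_blk.
Qed.

Lemma measurable_prox_br (X : T' -> profile G) i :
  measurable_row X -> (forall w, feasible (X w)) ->
  measurable_row (fun w => prox_br mu (X w) i).
Proof.
move=> mX fX; under eq_fun do rewrite -(profile_proj_id (fX _)).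
exact: (measurable_row_comp mX (@continuous_prox_br i)).
Qed.

Lemma measurable_pgrad_psi (X : T' -> profile G) (S : T' -> (xdim G).-tuple R) i :
  measurable_row X -> (forall w, feasible (X w)) -> measurable_fun setT S ->
  measurable_row (fun w => pgrad i (fun y => psi i y (S w)) (X w)).
Proof.
move=> mX fX mS c; have [_ /(_ i c) mpsi] := wpG.
set n := (\sum_j sdim j)%N in mpsi *.
pose U w := ([tuple X w 0 b | b < n] : n.-tuple R, S w).
have rowU w : \row_b tnth (U w).1 b = X w by apply/rowP => b; rewrite mxE tnth_mktuple.
have mU : measurable_fun setT U.
  apply: measurable_fun_pair => //; apply/measurable_fun_tnthP => b /=.
  rewrite (_ : _ \o _ = fun w => X w 0 b); first exact: mX.
  by apply/funext => w /=; rewrite tnth_mktuple.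
(* [well_posed] gives measurability on feasible arguments only, so the composition needs that set to
   be measurable and to contain the range of [U]. *)
have := measurable_comp (F := [set u : n.-tuple R * (xdim G).-tuple R |
  feasible (\row_b tnth u.1 b : profile G)]) _ _ mpsi mU.
rewrite (_ : _ \o U = (fun w => pgrad i (fun y => psi i y (S w)) (X w) 0 c)); last first.
  by apply/funext => w /=; rewrite rowU.
apply; last by move=> _ [w _ <-] /=; rewrite rowU.
rewrite (_ : [set u | _] = [set u : n.-tuple R | feasible (\row_b tnth u b : profile G)] `*` setT).
  by apply: measurableX => //; exact: measurable_feasible.
by apply/seteqP; split => u //= [].
Qed.

Lemma strat_sa_inner i x (s : nat -> (xdim G).-tuple R) r :
  feasible x -> strat (sa_inner mu i x s r).
Proof.
case: r => [|r] fx /=; first exact: fx.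
set y := (_ - _).
by have [] := proj_spec y (strat_compact HA (i := i)) (strat_nonempty i).
Qed.

Lemma measurable_proj i (Y : T' -> 'rV[R]_(sdim i)) :
  measurable_row Y -> measurable_row (fun w => proj (strat (i := i)) (Y w)).
Proof.
move=> mY; apply: (measurable_row_comp mY).
apply: (@lipschitz_enorm_continuous _ _ _ 1) => x y; rewrite mul1r.
apply: proj_nonexpansive; [exact: strat_compact HA _|exact: strat_convex HA _|exact: strat_nonempty].
Qed.

Lemma measurable_sa_step (X : T' -> profile G) i (Z : T' -> 'rV[R]_(sdim i))
    (S : T' -> (xdim G).-tuple R) (gamma : R) :
  measurable_row X -> (forall w, feasible (X w)) ->
  measurable_row Z -> (forall w, strat (Z w)) -> measurable_fun setT S ->
  measurable_row (fun w => proj (strat (i := i)) (Z w - gamma *: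
    (pgrad i (fun y => psi i y (S w)) (repl (X w) (Z w)) + mu *: (Z w - blk (X w) i)))).
Proof.
move=> mX fX mZ sZ mS; apply: measurable_proj; apply: measurable_rowB => //.
apply: measurable_rowZ; apply: measurable_rowD.
  apply: measurable_pgrad_psi => //; first exact: measurable_repl.
  by move=> w; apply: feasible_repl => //; exact: feasible_rivals.
by apply: measurable_rowZ; apply: measurable_rowB => //; exact: measurable_blk.
Qed.

Lemma measurable_sa_inner (X : T' -> profile G) i (S : nat -> T' -> (xdim G).-tuple R) r :
  measurable_row X -> (forall w, feasible (X w)) ->
  (forall t, (0 < t <= r)%N -> measurable_fun setT (S t)) ->
  measurable_row (fun w => sa_inner mu i (X w) (fun t => S t w) r).
Proof.
move=> mX fX; elim: r => [_|r IH mS]; first exact: measurable_blk.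
apply: measurable_sa_step => //.
- by apply: IH => t /andP[t0 tr]; apply: mS; rewrite t0 leqW.
- by move=> w; exact: strat_sa_inner.
- by apply: mS; rewrite ltnS leqnn.
Qed.

End Measurable_maps.

Section Runs.
Context (j : player -> nat -> nat) (x0 : T -> profile G)
  (smp : player -> nat -> nat -> T -> (xdim G).-tuple R).

Lemma feasible_sa_iter k w : (forall w, feasible (x0 w)) -> feasible (sa_iter mu j x0 smp k w).
Proof.
move=> fx0; elim: k => [|k IH] /=; first exact: fx0.
by move=> i; rewrite /blk mxrowK; exact: strat_sa_inner.
Qed.

Lemma blk_sa_iterS k w i : blk (sa_iter mu j x0 smp k.+1 w) i =
  sa_inner mu i (sa_iter mu j x0 smp k w) (fun t => smp i k t w) (j i k).-1.
Proof. by rewrite /= /blk mxrowK. Qed.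

(** The domain [T'] is free so that the same induction serves the ambient sigma-algebra and one
    generated by past samples only. *)
Lemma measurable_sa_iter (d' : measure_display) (T' : measurableType d') (p : T' -> T) k :
  (forall w, feasible (x0 w)) -> measurable_row (x0 \o p) ->
  (forall i l t, (l < k)%N -> (0 < t <= j i l)%N -> measurable_fun setT (smp i l t \o p)) ->
  measurable_row (sa_iter mu j x0 smp k \o p).
Proof.
move=> fx0 mx0; elim: k => [//|k IH] mS; apply: measurable_profile => i.
rewrite (_ : (fun w => _) = (fun w => sa_inner mu i ((sa_iter mu j x0 smp k \o p) w)
    (fun t => (smp i k t \o p) w) (j i k).-1)); last first.
  by apply/funext => w; rewrite /comp blk_sa_iterS.
apply: measurable_sa_inner.
- by apply: IH => i' l t lk; apply: mS; exact: leqW.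
- by move=> w; exact: feasible_sa_iter.
- move=> t /andP[t0 tj]; apply: mS => //; rewrite t0/=.
  by apply: leq_trans tj _; exact: leq_pred.
Qed.

End Runs.
End Game_measurability.

(** * Conditional expectation and independent samples *)

Section Sub_sigma_algebra.
Context {R : realType} {d : measure_display} {T : measurableType d}
  (P : probability T R) (gen : set (set T)) (sub : <<s gen>> `<=` measurable).
Local Open Scope ereal_scope.

(** The identity, with the smaller sigma-algebra on its target; its law is the restriction of
    [P]. *)
Definition to_sub (w : T) : g_sigma_algebraType gen := w.

Lemma measurable_to_sub : measurable_fun setT to_sub.
Proof. by move=> _ B mB; rewrite setTI; exact: sub. Qed.

Definition to_sub_mfun : {mfun T >-> g_sigma_algebraType gen} :=
  mfun_Sub (mem_set measurable_to_sub).

Lemma sub_integral_distribution (h : g_sigma_algebraType gen -> \bar R) :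
  measurable_fun setT h -> (forall w, 0 <= h w) ->
  \int[distribution P to_sub_mfun]_w h w = \int[P]_w h w.
Proof. by move=> mh h0; rewrite ge0_integral_distribution. Qed.

Lemma sub_integrable (h : g_sigma_algebraType gen -> \bar R) :
  (distribution P to_sub_mfun).-integrable setT h -> P.-integrable setT (h : T -> \bar R).
Proof.
move=> /integrableP[mh ih]; apply/integrableP; split.
  by apply: measurable_comp mh measurable_to_sub => //; exact: sub.
have := ih; rewrite (@sub_integral_distribution (fun w => `|h w|))//.
exact: measurableT_comp.
Qed.

(** The version is the Radon-Nikodym derivative, on the sub-sigma-algebra, of the charge with
    density [X]. The charge is built from [|X|], which is [X] by nonnegativity. *)
Lemma cond_exp_exists (X : T -> R) :
  P.-integrable setT (EFin \o X) -> (forall w, (0 <= X w)%R) ->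
  exists Y, is_cond_exp P <<s gen>> X Y.
Proof.
move=> iX X0.
have iaX : P.-integrable setT (abse \o (EFin \o X)) by exact: integrable_abse.
pose nu := pushforward (induced_charge iaX) to_sub_mfun.
have numu : nu `<< distribution P to_sub_mfun.
  apply: dominates_pushforward; first exact: measurable_to_sub.
  have := dominates_induced iX; set iaX' := (X in induced_charge X).
  by rewrite (Prop_irrelevance iaX' iaX).
pose D0 := Radon_Nikodym (pushforward (induced_charge iaX) to_sub_mfun : {charge set _ -> \bar R})
  (distribution P to_sub_mfun).
pose D := D0 measurable_to_sub.
have D1 : (distribution P to_sub_mfun).-integrable setT D by apply: Radon_Nikodym_integrable; exact: numu.
have Dfin w : D w \is a fin_num by apply: Radon_Nikodym_fin_num; exact: numu.
exists (fine \o D).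
have DE : EFin \o (fine \o D) = D by apply/funext => w /=; rewrite fineK.
have mD : measurable_fun setT D by case/integrableP : D1.
split.
- move=> B mB; have mfD : measurable_fun setT (fine \o D).
    by apply: measurableT_comp => //; exact: measurable_fine.
  by have := mfD measurableT B mB; rewrite setTI.
- by rewrite DE; exact: sub_integrable.
- move=> A gA; have -> : \int[P]_(w in A) (X w)%:E = nu A.
    rewrite /nu /pushforward /induced_charge; apply: eq_integral => w _ /=.
    by rewrite ger0_norm.
  have -> : nu A = \int[distribution P to_sub_mfun]_(w in A) D w.
    by apply: Radon_Nikodym_integral => //; exact: numu.
  rewrite integral_pushforward//; last first.
    by apply: (integrableS measurableT) => //; [exact: sub|exact: sub_integrable].
  by apply: eq_integral => w _; rewrite /= fineK.
Qed.

(** Testing on the event [Y > r], which belongs to the sub-sigma-algebra, gives a nonpositive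
    integral of the positive function [Y - r]; the event is null. *)
Lemma cond_exp_le_of_integral (X : T -> R) (r : R) :
  P.-integrable setT (EFin \o X) -> (forall w, (0 <= X w)%R) ->
  (forall A, <<s gen>> A -> \int[P]_(w in A) (X w)%:E <= r%:E * P A) ->
  cond_exp_le P <<s gen>> X r.
Proof.
move=> iX X0 HX; have [Y [mY iY YX]] := cond_exp_exists iX X0.
exists Y => //.
pose A := Y @^-1` `]r, +oo[%classic.
have gA : <<s gen>> A by apply: mY; exact: measurable_itv.
have mA : measurable A by exact: sub.
have iYA : P.-integrable A (EFin \o Y) by exact: integrableS iY.
have ir : P.-integrable A (EFin \o cst r).
  by apply: (integrableS measurableT) => //; exact: finite_measure_integrable_cst.
have : \int[P]_(w in A) `|(Y w - r)%:E| = 0.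
  apply/eqP; rewrite eq_le integral_ge0// andbT.
  rewrite (eq_integral ((EFin \o Y) \- (EFin \o cst r))); last first.
    by move=> w; rewrite inE /A/= in_itv/= andbT => rY; rewrite ger0_norm ?subr_ge0 ?ltW.
  rewrite integralB//= YX// integral_cst// sube_le0.
  exact: HX.
have mYr : measurable_fun A (fun w => (Y w - r)%:E).
  apply/measurable_EFinP; apply: measurable_funB => //.
  by apply/measurable_EFinP; case/integrableP : iYA.
move/(ae_eq_integral_abs P mA mYr).1; apply: filterS => w Hw.
rewrite leNgt; apply/negP => rY; have := Hw.
rewrite /A/= in_itv/= rY => /(_ isT)[/eqP]; rewrite subr_eq0 => /eqP Yr.
by rewrite Yr ltxx in rY.
Qed.

Context {d2 : measure_display} {T2 : measurableType d2}.

(* The pair (w, S w) pushes [P] forward to the product of the restriction of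
   [P] to the sub-sigma-algebra and the law of [S]. *)
Lemma independent_integral_le (S S' : T -> T2) (h : g_sigma_algebraType gen * T2 -> \bar R)
    (B : T -> \bar R) :
  measurable_fun setT S -> measurable_fun setT S' ->
  (forall C, measurable C -> P (S @^-1` C) = P (S' @^-1` C)) ->
  (forall A C, <<s gen>> A -> measurable C ->
     P (A `&` S @^-1` C) = P A * P (S @^-1` C)) ->
  measurable_fun setT h -> (forall u, 0 <= h u) -> measurable_fun setT B ->
  (forall w, \int[P]_w' h (w, S' w') <= B w) ->
  \int[P]_w h (w, S w) <= \int[P]_w B w.
Proof.
move=> mS mS' law indep mh h0 mB hB.
have mJ : measurable_fun setT (fun w => (to_sub w, S w)).
  by apply: measurable_fun_pair => //; exact: measurable_to_sub.
pose J : {mfun T >-> (g_sigma_algebraType gen * T2)%type} := mfun_Sub (mem_set mJ).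
pose mS'f : {mfun T >-> T2} := mfun_Sub (mem_set mS').
pose m1 := distribution P to_sub_mfun; pose m2 := distribution P mS'f.
have -> : \int[P]_w h (w, S w) = \int[distribution P J]_u h u.
  by rewrite ge0_integral_distribution.
rewrite (@eq_measure_integral _ _ _ _ (m1 \x m2)); last first.
  move=> A mA _; apply/esym; apply: product_measure_unique => // B1 B2 mB1 mB2.
  by have := indep _ _ mB1 mB2; rewrite (law _ mB2); exact.
have mF : measurable_fun setT (fubini_F m2 h) by exact: measurable_fun_fubini_tonelli_F.
have F0 w : 0 <= fubini_F m2 h w by exact: integral_ge0.
rewrite fubini_tonelli1// sub_integral_distribution//; apply: ge0_le_integral => //.
- by apply: measurable_comp mF measurable_to_sub => //; exact: sub.
- move=> w _; apply: le_trans (hB w).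
  by rewrite /fubini_F ge0_integral_distribution//; exact: measurableT_comp.
Qed.

End Sub_sigma_algebra.

(** * One stochastic approximation step *)

Lemma integral_probability_cst (R : realType) (d : measure_display) (T : measurableType d)
    (P : probability T R) (r : R) : (\int[P]_w cst r%:E w = r%:E)%E.
Proof.
transitivity (r%:E * P setT)%E; last by rewrite probability_setT mule1.
by rewrite -(integral_cst P measurableT r%:E).
Qed.

(** Monotonicity of the gradient between [z] and [p], together with the variational inequality at
    [p], makes the proximal gradient [mu]-strongly monotone towards [p]. *)
Lemma strong_drift (R : realType) (n : nat) (mu : R) (g g' z p b : 'rV[R]_n) :
  0 <= dotv (g - g') (z - p) -> 0 <= dotv (g' + mu *: (p - b)) (z - p) ->
  mu * enorm (z - p) ^+ 2 <= dotv (z - p) g + mu * dotv (z - p) (z - b).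
Proof.
have -> : z - b = (z - p) + (p - b) by rewrite addrA subrK.
move: (z - p) (p - b) => u v; rewrite dotvBl dotvDl dotvZl !(dotvC _ u) dotvDr -enorm_sq.
by lra.
Qed.

(** The two terms of [Qconst] originate in [|g + mu v|^2 <= 2 |g|^2 + 2 mu^2 D^2]. The right side is
    arranged as a quadratic in [g], the form that [sampled_quadratic] integrates. *)
Lemma gradient_step_sq (R : realType) (n : nat) (mu gamma D : R) (g u v : 'rV[R]_n) :
  0 <= mu -> 0 <= gamma -> enorm v <= D ->
  enorm (u - gamma *: (g + mu *: v)) ^+ 2 <=
    enorm u ^+ 2 - 2 * gamma * mu * dotv u v + 2 * gamma ^+ 2 * mu ^+ 2 * D ^+ 2
    + - (2 * gamma) * dotv u g + 2 * gamma ^+ 2 * enorm g ^+ 2.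
Proof.
move=> mu0 g0 vD.
have sq : enorm (g + mu *: v) ^+ 2 <= 2 * enorm g ^+ 2 + 2 * (mu ^+ 2 * D ^+ 2).
  apply: (@le_trans _ _ (2 * enorm g ^+ 2 + 2 * enorm (mu *: v) ^+ 2)).
    by have := sqr_ge0 (enorm (g - mu *: v)); rewrite enormD_sq enormB_sq; lra.
  have D0 : 0 <= D by apply: le_trans vD; exact: enorm_ge0.
  rewrite lerD2l ler_pM2l// -exprMn ler_pXn2r ?nnegrE ?enorm_ge0 ?mulr_ge0//.
  by rewrite enormZ ger0_norm// ler_wpM2l.
have {}sq := ler_wpM2l (sqr_ge0 gamma) sq.
rewrite enormB_sq enormZ (ger0_norm g0) dotvZr dotvDr dotvZr exprMn.
by move: sq; lra.
Qed.

Section Sa_step.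
Context {R : realType} {d : measure_display} {T : measurableType d}
  {P : probability T R} (G : sgame P).
Local Notation player := 'I_(nplayers G).
Context (M : player -> R) (HA : assumptionA M) (wpG : well_posed G)
  (mu : R) (mu0 : 0 < mu)
  (bounded_cross : forall i j : player, j != i -> has_ubound (cross_hess_norms i j))
  (x_ : profile G) (fx_ : feasible x_).
Implicit Types (i : player) (x : profile G).

Lemma enorm_le_diam i (z z' : 'rV[R]_(sdim i)) :
  strat z -> strat z' -> enorm (z - z') <= diam (strat (i := i)).
Proof.
move=> sz sz'; apply: ub_le_sup; last by exists (z, z').
have [B [_ HB]] := compact_bounded (strat_compact HA (i := i)).
have {}HB (u : 'rV[R]_(sdim i)) : strat u -> `|u| <= B + 1.
  by move=> su; apply: (HB (B + 1) _ u su); rewrite ltrDl.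
exists ((sdim i)%:R * (B + 1 + (B + 1))) => _ [[u v] [/= su sv] <-].
apply: le_trans (enorm_le_norm _) _; rewrite ler_wpM2l//.
by apply: le_trans (ler_normB _ _) _; rewrite lerD ?HB.
Qed.

Lemma diam_ge0 i : 0 <= diam (strat (i := i)).
Proof. by apply: le_trans (enorm_le_diam (fx_ i) (fx_ i)); exact: enorm_ge0. Qed.

Lemma Qconst_gt0 i : 0 < Qconst mu M i.
Proof.
have [_ _ _ [M0 _]] := HA i.
by apply: ltr_pwDl; [rewrite divr_gt0 ?mulr_gt0 ?exprn_gt0|rewrite mulr_ge0 ?sqr_ge0].
Qed.

Section One_sample.
Context (i : player) (x : profile G) (fx : feasible x).

Let g w := pgrad i (fun y => psi i y (xi G w)) x.

Let mg : measurable_row g.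
Proof.
apply: (measurable_pgrad_psi HA wpG fx_ (X := fun=> x)) => //; exact: measurable_xi.
Qed.

Let g_sq : (\int[P]_w (enorm (g w) ^+ 2)%:E <= (M i ^+ 2)%:E)%E.
Proof. by have [_ _ _ [_ /(_ x fx)]] := HA i; rewrite unlock. Qed.

Let mg_sq : measurable_fun setT (fun w => enorm (g w) ^+ 2).
Proof. by apply: measurable_funX; exact: measurable_enorm. Qed.

Let ig_sq : P.-integrable setT (fun w => (enorm (g w) ^+ 2)%:E).
Proof.
apply/integrableP; split; first exact/measurable_EFinP.
under eq_integral do rewrite /= ger0_norm ?sqr_ge0//.
by apply: le_lt_trans g_sq _; rewrite ltry.
Qed.

(** A finite second moment suffices, since [|g_c| <= |g| <= |g|^2 + 1]. *)
Let ig c : P.-integrable setT (fun w => (g w 0 c)%:E).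
Proof.
apply: (@le_integrable _ _ _ P setT measurableT _ (fun w => (enorm (g w) ^+ 2 + 1)%:E)).
- by apply/measurable_EFinP; exact: mg.
- move=> w _ /=; rewrite lee_fin [leRHS]ger0_norm ?addr_ge0 ?sqr_ge0//.
  by apply: le_trans (abs_coord_le_enorm _ _) _; nra.
- under eq_fun do rewrite EFinD.
  apply: integrableD => //; exact: finite_measure_integrable_cst.
Qed.

Lemma dotv_sampled_gradient (u : 'rV[R]_(sdim i)) :
  P.-integrable setT (fun w => (dotv u (g w))%:E) /\
  (\int[P]_w (dotv u (g w))%:E = (dotv u (pgrad i (f i) x))%:E)%E.
Proof.
have E w : (dotv u (g w))%:E = (\sum_c (u 0 c)%:E * (g w 0 c)%:E)%E.
  by rewrite sumEFin.
have iu c : P.-integrable setT (fun w => (u 0 c)%:E * (g w 0 c)%:E)%E by exact: integrableZl.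
split; first by under eq_fun do rewrite E; exact: integrable_sum.
under eq_integral do rewrite E.
rewrite integral_sum// -sumEFin; apply: eq_bigr => c _.
rewrite integralZl//; have [_ _ [_ /(_ x c fx) H] _] := HA i.
by rewrite EFinM H unlock.
Qed.

Lemma sampled_quadratic (a b s : R) (u : 'rV[R]_(sdim i)) : 0 <= s ->
  P.-integrable setT (fun w => (a + b * dotv u (g w) + s * enorm (g w) ^+ 2)%:E) /\
  (\int[P]_w (a + b * dotv u (g w) + s * enorm (g w) ^+ 2)%:E <=
     (a + b * dotv u (pgrad i (f i) x) + s * M i ^+ 2)%:E)%E.
Proof.
move=> s0; have [iu Eu] := dotv_sampled_gradient u.
have ia : P.-integrable setT (EFin \o cst a) by exact: finite_measure_integrable_cst.
have ib : P.-integrable setT (fun w => b%:E * (dotv u (g w))%:E)%E by exact: integrableZl.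
have isq : P.-integrable setT (fun w => s%:E * (enorm (g w) ^+ 2)%:E)%E by exact: integrableZl.
have E w : (a + b * dotv u (g w) + s * enorm (g w) ^+ 2)%:E =
    ((EFin \o cst a) w + b%:E * (dotv u (g w))%:E + s%:E * (enorm (g w) ^+ 2)%:E)%E.
  by rewrite !EFinD !EFinM.
have iab : P.-integrable setT (fun w => (EFin \o cst a) w + b%:E * (dotv u (g w))%:E)%E.
  exact: integrableD.
split; first by under eq_fun do rewrite E; exact: integrableD.
under eq_integral do rewrite E.
have Ea : (\int[P]_w (EFin \o cst a) w = a%:E)%E by exact: integral_probability_cst.
rewrite integralD// integralD// Ea.
rewrite integralZl// integralZl// Eu !EFinD !EFinM leeD2l//.
by apply: lee_pmul => //; apply: integral_ge0 => w _; rewrite lee_fin sqr_ge0.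
Qed.

End One_sample.

(** With the state frozen only the sample is random. As [p] is its own projection, nonexpansiveness
    removes the projection, and [strong_drift] turns the cross terms into
    [- 2 gamma mu |z - p|^2]. *)
Lemma sa_step_deterministic i x (z p : 'rV[R]_(sdim i)) (gamma : R) :
  feasible x -> strat z -> vi_solution mu x p -> 0 <= gamma ->
  (\int[P]_w (enorm (proj (strat (i := i)) (z - gamma *:
      (pgrad i (fun y => psi i y (xi G w)) (repl x z) + mu *: (z - blk x i))) - p) ^+ 2)%:E
   <= ((1 - 2 * gamma * mu) * enorm (z - p) ^+ 2 + gamma ^+ 2 * mu ^+ 2 * Qconst mu M i)%:E)%E.
Proof.
move=> fx sz [sp vp] g0.
have fxi := feasible_rivals fx (i := i).
have fz : feasible (repl x z) by exact: feasible_repl.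
pose g w := pgrad i (fun y => psi i y (xi G w)) (repl x z).
pose D := diam (strat (i := i)).
have vD : enorm (z - blk x i) <= D by apply: enorm_le_diam => //; exact: fx.
have := strong_drift (pgrad_f_monotone HA fxi sz sp) (vp z sz).
set u := z - p; set v := z - blk x i in vD *; set df := pgrad i (f i) _ => drift.
pose A0 := enorm u ^+ 2 - 2 * gamma * mu * dotv u v + 2 * gamma ^+ 2 * mu ^+ 2 * D ^+ 2.
have s0 : 0 <= 2 * gamma ^+ 2 by rewrite mulr_ge0 ?sqr_ge0.
have [ih Eh] := sampled_quadratic fz A0 (- (2 * gamma)) u s0.
apply: (@le_trans _ _ (\int[P]_w
    (A0 + - (2 * gamma) * dotv u (g w) + 2 * gamma ^+ 2 * enorm (g w) ^+ 2)%:E)%E).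
  apply: ge0_le_integral => //.
  - by move=> w _; rewrite lee_fin sqr_ge0.
  - apply/measurable_EFinP; apply: measurable_funX; apply: measurable_enorm.
    apply: measurable_rowB; last by move=> c; exact: measurable_cst.
    apply: (measurable_sa_step HA wpG mu fx_ (X := fun=> x) (Z := fun=> z)) => //; exact: measurable_xi.
  - by case/integrableP : ih.
  move=> w _; rewrite lee_fin -/(g w).
  have H1 : enorm (proj (strat (i := i)) (z - gamma *: (g w + mu *: v)) - p) <=
            enorm (u - gamma *: (g w + mu *: v)).
    rewrite -{1}(proj_id (strat_compact HA (i := i)) sp).
    apply: le_trans (proj_nonexpansive _ _ (strat_compact HA (i := i)) (strat_convex HA (i := i)) _) _.
      by exists p.
    by rewrite /u [z - p - _]addrAC.
  apply: le_trans (_ : enorm (u - gamma *: (g w + mu *: v)) ^+ 2 <= _).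
    by rewrite ler_pXn2r ?nnegrE ?enorm_ge0.
  by apply: gradient_step_sq => //; exact: ltW.
apply: le_trans Eh _; rewrite lee_fin -/df /A0 /Qconst -/D.
have {}drift := ler_wpM2l g0 drift.
move: (dotv u df) (dotv u v) (enorm u ^+ 2) drift => a b e drift.
have -> : gamma ^+ 2 * mu ^+ 2 * (2 * M i ^+ 2 / mu ^+ 2 + 2 * D ^+ 2) =
    gamma ^+ 2 * (2 * M i ^+ 2 + 2 * mu ^+ 2 * D ^+ 2).
  by field; rewrite gt_eqF.
by clear -drift; lra.
Qed.

End Sa_step.

(** * The inner stochastic approximation loop *)

Lemma integral_indicM (R : realType) (d : measure_display) (T : measurableType d)
    (P : probability T R) (A : set T) (h : T -> R) :
  (\int[P]_(w in A) (h w)%:E = \int[P]_w (\1_A w * h w)%:E)%E.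
Proof.
rewrite integral_mkcond; apply: eq_integral => w _.
by rewrite /patch indicE; case: ifP; rewrite ?mul1r ?mul0r.
Qed.

Lemma measurable_fun_generated (d : measure_display) (T : measurableType d)
    (d2 : measure_display) (T2 : measurableType d2) (gen : set (set T)) (S : T -> T2) :
  preimage_set_system setT S measurable `<=` gen ->
  measurable_fun setT (S : g_sigma_algebraType gen -> T2).
Proof. by move=> H _ B mB; apply: sub_sigma_algebra; apply: H; exists B. Qed.

(** With [x = n + 2] the left side is [Q (x - 1) / x^2], and [(x - 1) (x + 1) <= x^2]. *)
Lemma sa_rate (R : realType) (Q : R) (n : nat) : 0 <= Q ->
  (1 - 2 / n.+2%:R) * (Q / n.+2%:R) + Q / n.+2%:R ^+ 2 <= Q / n.+3%:R.
Proof.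
move=> Q0; have -> : n.+3%:R = n.+2%:R + 1 :> R by rewrite natr1.
have : 0 < n.+2%:R :> R by rewrite ltr0n.
move: (n.+2%:R : R) => x x0; have x1 : 0 < x + 1 by rewrite ltr_wpDr.
rewrite ler_pdivlMr//.
have -> : ((1 - 2 / x) * (Q / x) + Q / x ^+ 2) * (x + 1) = Q - Q / x ^+ 2.
  by field; rewrite gt_eqF.
by rewrite gerBl divr_ge0// sqr_ge0.
Qed.

Section Sa_inner_bound.
Context {R : realType} {d : measure_display} {T : measurableType d}
  {P : probability T R} (G : sgame P).
Local Notation player := 'I_(nplayers G).
Context (M : player -> R) (HA : assumptionA M) (wpG : well_posed G)
  (mu : R) (mu0 : 0 < mu)
  (bounded_cross : forall i j : player, j != i -> has_ubound (cross_hess_norms i j))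
  (x_ : profile G) (fx_ : feasible x_).
Implicit Types (i : player) (x : profile G).

(** A conditional inequality in integrated form: [X] and [Z] are known to [gen] and [S] is
    independent of it, so they may be frozen while [S] is integrated. The indicator of [A] enters
    the integrand so that Tonelli applies on the whole space. *)
Lemma sa_step_mean i (gen : set (set T)) (X : g_sigma_algebraType gen -> profile G)
    (Z : g_sigma_algebraType gen -> 'rV[R]_(sdim i))
    (S : T -> (xdim G).-tuple R) (gamma : R) (A : set T) :
  <<s gen>> `<=` measurable ->
  measurable_row X -> (forall w, feasible (X w)) ->
  measurable_row Z -> (forall w, strat (Z w)) -> measurable_fun setT S ->
  (forall B, measurable B -> P (S @^-1` B) = P (xi G @^-1` B)) ->
  (forall A B, <<s gen>> A -> measurable B -> P (A `&` S @^-1` B) = (P A * P (S @^-1` B))%E) ->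
  <<s gen>> A -> 0 <= gamma -> 0 <= 1 - 2 * gamma * mu ->
  (\int[P]_(w in A) (enorm (proj (strat (i := i)) (Z w - gamma *:
      (pgrad i (fun y => psi i y (S w)) (repl (X w) (Z w)) + mu *: (Z w - blk (X w) i)))
      - prox_br mu (X w) i) ^+ 2)%:E
   <= \int[P]_(w in A) ((1 - 2 * gamma * mu) * enorm (Z w - prox_br mu (X w) i) ^+ 2
        + gamma ^+ 2 * mu ^+ 2 * Qconst mu M i)%:E)%E.
Proof.
move=> sub mX fX mZ sZ mS law indep gA g0 g1.
pose step w s := proj (strat (i := i)) (Z w - gamma *:
  (pgrad i (fun y => psi i y s) (repl (X w) (Z w)) + mu *: (Z w - blk (X w) i))).
have mp : measurable_row (fun w => prox_br mu (X w) i : 'rV[R]_(sdim i)).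
  exact: (measurable_prox_br HA mu0 bounded_cross fx_).
have mA : measurable (A : set (g_sigma_algebraType gen)) by [].
have mind : measurable_fun setT (\1_A : g_sigma_algebraType gen -> R).
  exact: measurable_indic.
rewrite !(@integral_indicM _ _ _ P A).
pose h (u : g_sigma_algebraType gen * (xdim G).-tuple R) :=
  (\1_A u.1 * enorm (step u.1 u.2 - prox_br mu (X u.1) i) ^+ 2)%:E.
have mfst (n : nat) (V : g_sigma_algebraType gen -> 'rV[R]_n) : measurable_row V ->
    measurable_row (fun u : g_sigma_algebraType gen * (xdim G).-tuple R => V u.1).
  by move=> mV c; apply: (measurableT_comp (mV c)); exact: measurable_fst.
have mto (B : g_sigma_algebraType gen -> R) : measurable_fun setT B ->
    measurable_fun setT (B : T -> R).
  by move=> mB; apply: (measurableT_comp mB); exact: measurable_to_sub sub.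
apply: (@independent_integral_le _ _ _ P gen sub _ _ S (xi G) h) => //.
- exact: measurable_xi.
- apply/measurable_EFinP; apply: measurable_funM.
    by apply: (measurableT_comp mind); exact: measurable_fst.
  apply: measurable_funX; apply: measurable_enorm; apply: measurable_rowB; last exact: (mfst _ _ mp).
  apply: (measurable_sa_step HA wpG mu fx_ (X := fun u => X u.1) (Z := fun u => Z u.1)
    (S := snd)) => //; [exact: (mfst _ _ mX)|exact: (mfst _ _ mZ)].
- by move=> u; rewrite lee_fin mulr_ge0 ?sqr_ge0.
- apply/measurable_EFinP; apply: mto; apply: measurable_funM => //.
  apply: measurable_funD; last exact: measurable_cst.
  apply: measurable_funM; first exact: measurable_cst.
  by apply: measurable_funX; apply: measurable_enorm; exact: measurable_rowB.
move=> w; rewrite /h/= indicE; case: (w \in A); last first.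
  by under eq_integral do rewrite mul0r; rewrite integral0 mul0r.
under eq_integral do rewrite mul1r.
rewrite mul1r; apply: (sa_step_deterministic HA wpG mu0 fx_) => //.
exact: (prox_br_vi HA mu i (fX w)).
Qed.

Context (j : player -> nat -> nat) (x0 : T -> profile G)
  (smp : player -> nat -> nat -> T -> (xdim G).-tuple R) (run : sa_run j x0 smp).

Definition inner_gen i (k t : nat) : set (set T) :=
  history_gen j x0 smp k `|`
    [set A | exists2 s, (0 < s < t)%N & preimage_set_system setT (smp i k s) measurable A].

Lemma history_gen_measurable k : history_gen j x0 smp k `<=` measurable.
Proof.
have [mx0 _ ms] := run.
move=> A [[c [B mB <-]]|[i [l [t [lk tj [B mB <-]]]]]]; first exact: mx0.
by have [mS _ _] := ms i l t tj; exact: mS.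
Qed.

Lemma history_measurable k : history j x0 smp k `<=` measurable.
Proof.
by apply: smallest_sub; [exact: sigma_algebra_measurable|exact: history_gen_measurable].
Qed.

Lemma inner_gen_measurable i k t : (t <= j i k)%N -> <<s inner_gen i k t>> `<=` measurable.
Proof.
move=> tj; apply: smallest_sub; first exact: sigma_algebra_measurable.
move=> A [|[s /andP[s0 st] [B mB <-]]]; first exact: history_gen_measurable.
have [_ _ /(_ i k s)] := run; rewrite s0 (ltnW (leq_trans st tj)) => /(_ isT)[mS _ _].
exact: mS.
Qed.

Lemma measurable_sa_iter_generated k (gen : set (set T)) : history_gen j x0 smp k `<=` gen ->
  measurable_row (sa_iter mu j x0 smp k : g_sigma_algebraType gen -> profile G).
Proof.
move=> Hgen; have [_ fx0 _] := run.
apply: (measurable_sa_iter HA wpG mu fx_ (p := @id T) (T' := g_sigma_algebraType gen)) => //.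
  move=> c; apply: measurable_fun_generated.
  by move=> A HA'; apply: Hgen; left; exists c.
move=> i l t lk tj; apply: measurable_fun_generated.
by move=> A HA'; apply: Hgen; right; exists i, l, t.
Qed.

Lemma measurable_sa_iter_run k : measurable_row (sa_iter mu j x0 smp k).
Proof.
have [mx0 fx0 ms] := run.
apply: (measurable_sa_iter HA wpG mu fx_ (p := @id T)) => // i l t _ tj.
by have [] := ms i l t tj.
Qed.

Lemma measurable_sa_error i k r : (r < j i k)%N -> measurable_fun setT (fun w =>
  enorm (sa_inner mu i (sa_iter mu j x0 smp k w) (fun t => smp i k t w) r
      - prox_br mu (sa_iter mu j x0 smp k w) i) ^+ 2).
Proof.
move=> rj; have [mx0 fx0 ms] := run.
have mX := measurable_sa_iter_run k.
have fX w : feasible (sa_iter mu j x0 smp k w) by exact: (feasible_sa_iter HA mu fx_).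
apply: measurable_funX; apply: measurable_enorm; apply: measurable_rowB.
  apply: (measurable_sa_inner HA wpG mu fx_) => // t /andP[t0 tr].
  by have [] := ms i k t; rewrite // t0 (leq_trans tr (ltnW rj)).
exact: (measurable_prox_br HA mu0 bounded_cross fx_).
Qed.

Lemma sa_error_le_diam i k r w :
  enorm (sa_inner mu i (sa_iter mu j x0 smp k w) (fun t => smp i k t w) r
      - prox_br mu (sa_iter mu j x0 smp k w) i) ^+ 2 <= diam (strat (i := i)) ^+ 2.
Proof.
have [_ fx0 _] := run.
have fX : feasible (sa_iter mu j x0 smp k w) by exact: (feasible_sa_iter HA mu fx_).
rewrite ler_pXn2r ?nnegrE ?enorm_ge0 ?(diam_ge0 HA fx_)//.
by apply: (enorm_le_diam HA); [exact: (strat_sa_inner HA mu fx_)|exact: (prox_br_strat HA mu)].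
Qed.

(** [sa_inner] at [r] is the iterate numbered [r + 1], hence the denominator [r + 2]. The event [A]
    of the outer history belongs to every inner history, so each step is integrated over the same
    [A]. *)
Lemma sa_inner_mean i k r A : history j x0 smp k A -> (r < j i k)%N ->
  (\int[P]_(w in A) (enorm (sa_inner mu i (sa_iter mu j x0 smp k w) (fun t => smp i k t w) r
      - prox_br mu (sa_iter mu j x0 smp k w) i) ^+ 2)%:E
   <= (Qconst mu M i / r.+2%:R)%:E * P A)%E.
Proof.
move=> hA; have [_ fx0 ms] := run.
have mA : measurable A by exact: history_measurable hA.
pose X w := sa_iter mu j x0 smp k w.
have fX w : feasible (X w) by exact: (feasible_sa_iter HA mu fx_).
have sp w : strat (prox_br mu (X w) i) by exact: (prox_br_strat HA mu).
have Q0 : 0 <= Qconst mu M i by exact/ltW/(Qconst_gt0 HA mu0).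
have Afin : P A \is a fin_num by exact: fin_num_measure.
pose Z r w := sa_inner mu i (X w) (fun t => smp i k t w) r.
rewrite -/X; elim: r => [|r IH] rj.
  apply: (@le_trans _ _ (\int[P]_(w in A) cst (Qconst mu M i / 2)%:E w)%E).
    apply: ge0_le_integral => //.
    - by move=> w _; rewrite lee_fin sqr_ge0.
    - by apply/measurable_EFinP; apply: measurable_funTS; exact: (measurable_sa_error rj).
    move=> w _; rewrite lee_fin; apply: le_trans (sa_error_le_diam i k 0 w) _.
    (* The diameter term of [Qconst] carries a factor 2, so half of [Qconst] already dominates the
       initial squared error. *)
    have -> : Qconst mu M i / 2 = M i ^+ 2 / mu ^+ 2 + diam (strat (i := i)) ^+ 2.
      by rewrite /Qconst; field; rewrite gt_eqF.
    by rewrite lerDr divr_ge0// sqr_ge0.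
  by rewrite integral_cst.
have rj' : (r < j i k)%N by exact: ltnW.
have {IH} := IH rj'.
have [mS law indep] := ms i k r.+1 (ltnW rj).
pose gen := inner_gen i k r.+1.
have sub : <<s gen>> `<=` measurable by apply: inner_gen_measurable.
have mX : measurable_row (X : g_sigma_algebraType gen -> profile G).
  by apply: measurable_sa_iter_generated; exact: subsetUl.
have mZ : measurable_row (Z r : g_sigma_algebraType gen -> 'rV[R]_(sdim i)).
  apply: (measurable_sa_inner HA wpG mu fx_ (T' := g_sigma_algebraType gen)) => // t tr.
  by apply: measurable_fun_generated => B HB; right; exists t.
have gA : <<s gen>> A by apply: sub_sigma_algebra2 hA; exact: subsetUl.
have sZ w : strat (Z r w) by exact: (strat_sa_inner HA mu fx_).
pose gamma : R := 1 / (mu * r.+2%:R).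
have g0 : 0 <= gamma by rewrite divr_ge0// mulr_ge0// ltW.
have mun : mu != 0 by rewrite gt_eqF.
have n0 : r.+2%:R != 0 :> R by rewrite pnatr_eq0.
have gE : 2 * gamma * mu = 2 / r.+2%:R.
  by rewrite /gamma; move: (r.+2%:R : R) n0 => n n0; field; rewrite n0.
have gE2 : gamma ^+ 2 * mu ^+ 2 * Qconst mu M i = Qconst mu M i / r.+2%:R ^+ 2.
  rewrite /gamma; move: (Qconst mu M i) (r.+2%:R : R) n0 => q n n0; field.
  by rewrite n0.
have g1 : 0 <= 1 - 2 * gamma * mu by rewrite gE subr_ge0 ler_pdivrMr ?ltr0n// mul1r ler_nat.
have step := sa_step_mean sub mX fX mZ sZ mS law indep gA g0 g1.
move=> IH; apply: (le_trans step); rewrite gE2.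
have mu2 : measurable_fun A (fun w => (enorm (Z r w - prox_br mu (X w) i) ^+ 2)%:E).
  by apply/measurable_EFinP; apply: measurable_funTS; exact: (measurable_sa_error rj').
under eq_integral do rewrite EFinD EFinM.
rewrite ge0_integralD//; last 3 first.
- by move=> w _; rewrite mule_ge0// lee_fin ?sqr_ge0.
- exact: measurable_funeM.
- by move=> w _; rewrite lee_fin divr_ge0// sqr_ge0.
rewrite ge0_integralZl_EFin//; last by move=> w _; rewrite lee_fin sqr_ge0.
rewrite -[X in (_ + X)%E]/(\int[P]_(w in A) cst (Qconst mu M i / r.+2%:R ^+ 2)%:E w)%E integral_cst//.
apply: (@le_trans _ _ ((1 - 2 * gamma * mu)%:E * ((Qconst mu M i / r.+2%:R)%:E * P A)
   + (Qconst mu M i / r.+2%:R ^+ 2)%:E * P A)%E).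
  by rewrite leeD2r// lee_wpmul2l.
have := sa_rate r Q0; rewrite -gE => rate.
rewrite -(fineK Afin) -!EFinM -EFinD lee_fin mulrA -mulrDl.
by rewrite ler_wpM2r// fine_ge0.
Qed.

(** The next profile uses the inner iterate at index [j - 1], whose mean square error is
    [Q / (j + 1)]. *)
Lemma sa_run_inexact (alpha : player -> nat -> R) :
  (forall i k, (0 < j i k)%N) ->
  (forall i k, Qconst mu M i / (j i k).+1%:R <= alpha i k ^+ 2) ->
  inexact mu j x0 smp alpha.
Proof.
move=> j0 jalpha i k; have [mx0 fx0 ms] := run.
have jp : ((j i k).-1 < j i k)%N by rewrite prednK.
have mE := measurable_sa_error jp.
apply: cond_exp_le_of_integral.
- exact: history_measurable.
- under eq_fun do rewrite /= blk_sa_iterS.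
  apply: measurable_bounded_integrable => //.
    by rewrite (le_lt_trans (probability_le1 P measurableT))// ltry.
  exists (diam (strat (i := i)) ^+ 2); split; first exact: num_real.
  move=> B HB w _ /=; rewrite ger0_norm ?sqr_ge0//.
  by apply: le_trans (sa_error_le_diam i k _ w) _; exact: ltW.
- by move=> w; rewrite sqr_ge0.
move=> A hA; under eq_integral do rewrite blk_sa_iterS.
apply: le_trans (sa_inner_mean hA jp) _.
by rewrite prednK// lee_wpmul2r// lee_fin jalpha.
Qed.

End Sa_inner_bound.

(** * Convergence of the outer iteration *)

(** Bounds a first moment by a second one; equality at [s = c] means nothing is lost when [c] is the
    target root mean square. *)
Lemma amgm (R : realFieldType) (s c : R) : 0 < c -> s <= (2 * c)^-1 * s ^+ 2 + c / 2.
Proof.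
move=> c0; have -> : (2 * c)^-1 * s ^+ 2 + c / 2 = (s ^+ 2 + c ^+ 2) / (2 * c).
  by field; rewrite gt_eqF.
by rewrite ler_pdivlMr ?mulr_gt0//; have := sqr_ge0 (s - c); rewrite sqrrB; lra.
Qed.

Section Convergence.
Context {R : realType} {d : measure_display} {T : measurableType d}
  {P : probability T R} (G : sgame P).
Local Notation player := 'I_(nplayers G).
Local Notation N := (nplayers G).
Context (M : player -> R) (HA : assumptionA M) (wpG : well_posed G)
  (mu : R) (mu0 : 0 < mu)
  (bounded_cross : forall i j : player, j != i -> has_ubound (cross_hess_norms i j))
  (N0 : (0 < N)%N) (xs : profile G) (nx : nash xs).
Implicit Types (i : player) (x y : profile G).

Let a := specnorm (Gamma G mu).
Let fxs : feasible xs. Proof. by case: nx. Qed.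

Lemma enorm_blocks x : enorm x = enorm (\row_i enorm (blk x i)).
Proof.
rewrite !enormE -!enorm_sq enorm_profile_sq enorm_sq; congr Num.sqrt.
by apply: eq_bigr => i _; rewrite !mxE expr2.
Qed.

Definition prox_profile y : profile G := \mxrow_i prox_br mu y i.

Lemma blk_prox_profile y i : blk (prox_profile y) i = prox_br mu y i.
Proof. by rewrite /blk /prox_profile mxrowK. Qed.

(** The vector of block errors is dominated entrywise by [Gamma] applied to the vector of block
    distances; monotonicity of the norm then brings in the spectral norm. *)
Lemma prox_profile_contraction y : feasible y ->
  enorm (prox_profile y - xs) <= a * enorm (y - xs).
Proof.
move=> fy; rewrite enorm_blocks (enorm_blocks (y - xs)).
apply: le_trans (enorm_mulmx_le _ _); apply: enorm_mono => i.
rewrite mulmx_dotv mxE enorm_ge0/= blkB blk_prox_profile.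
apply: le_trans (prox_br_nash HA mu0 bounded_cross i nx fy) _.
by rewrite le_eqVlt; apply/orP; left; apply/eqP; apply: eq_bigr => j _; rewrite !mxE mulrC blkB.
Qed.

Lemma mean_distE (x : T -> profile G) : mean_dist xs x = (\int[P]_w (enorm (x w - xs))%:E)%E.
Proof.
rewrite /mean_dist unlock; apply: eq_integral => w _; congr EFin.
rewrite enormE -enorm_sq enorm_profile_sq; congr Num.sqrt.
by apply: eq_bigr => i _; rewrite blkB.
Qed.

Context (j : player -> nat -> nat) (x0 : T -> profile G)
  (smp : player -> nat -> nat -> T -> (xdim G).-tuple R) (run : sa_run j x0 smp)
  (j0 : forall i k, (0 < j i k)%N)
  (eta : R) (eta0 : 0 < eta)
  (jeta : forall i k, Qconst mu M i / (j i k).+1%:R <= (eta ^+ k.+1) ^+ 2).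
Local Notation X := (sa_iter mu j x0 smp).

Let fX k w : feasible (X k w).
Proof. by have [_ fx0 _] := run; exact: (feasible_sa_iter HA mu fxs). Qed.

Let mX k : measurable_row (X k).
Proof. exact: (measurable_sa_iter_run HA wpG mu fxs run). Qed.

Let mBX k : measurable_row (fun w => prox_profile (X k w)).
Proof.
apply: measurable_profile => i; under eq_fun do rewrite blk_prox_profile.
exact: (measurable_prox_br HA mu0 bounded_cross fxs).
Qed.

Lemma mean_inexactness k :
  (\int[P]_w (enorm (X k.+1 w - prox_profile (X k w)) ^+ 2)%:E <=
     (N%:R * (eta ^+ k.+1) ^+ 2)%:E)%E.
Proof.
have jp i : ((j i k).-1 < j i k)%N by rewrite prednK.
pose e i w := enorm (sa_inner mu i (X k w) (fun t => smp i k t w) (j i k).-1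
      - prox_br mu (X k w) i) ^+ 2.
rewrite (eq_integral (fun w => \sum_i (e i w)%:E)%E); last first.
  move=> w _; rewrite sumEFin enorm_profile_sq; congr EFin; apply: eq_bigr => i _.
  by rewrite blkB blk_sa_iterS blk_prox_profile.
rewrite ge0_integral_sum//; last 2 first.
- by move=> i; apply/measurable_EFinP; exact: (measurable_sa_error HA wpG mu0 bounded_cross fxs run (jp i)).
- by move=> i w _; rewrite lee_fin sqr_ge0.
apply: (@le_trans _ _ (\sum_(i < N) ((eta ^+ k.+1) ^+ 2)%:E)%E); last first.
  by rewrite sumEFin sumr_const card_ord mulr_natl.
apply: lee_sum => i _.
have hT : history j x0 smp k setT by rewrite -setC0; exact: sigma_algebraC (sigma_algebra0 _).
apply: le_trans (sa_inner_mean HA wpG mu0 bounded_cross fxs run hT (jp i)) _.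
by rewrite prednK// probability_setT mule1 lee_fin.
Qed.

Lemma mean_dist_step k :
  (mean_dist xs (X k.+1) <= a%:E * mean_dist xs (X k) + (Num.sqrt N%:R * eta ^+ k.+1)%:E)%E.
Proof.
(* The square of this weight is exactly the bound of [mean_inexactness], so integrating [amgm] gives
   [(2 c)^-1 * c^2 + c / 2 = c]. *)
pose c := Num.sqrt N%:R * eta ^+ k.+1.
have sN : 0 < Num.sqrt (N%:R : R) by rewrite sqrtr_gt0 ltr0n.
have c0 : 0 < c by rewrite mulr_gt0// exprn_gt0.
have a0 : 0 <= a by exact: specnorm_ge0.
pose s w := enorm (X k.+1 w - prox_profile (X k w)).
pose e w := enorm (X k w - xs).
have ms2 : measurable_fun setT (fun w => (s w ^+ 2)%:E).
  by apply/measurable_EFinP; apply: measurable_funX; apply: measurable_enorm; exact: measurable_rowB.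
have me : measurable_fun setT (fun w => (e w)%:E).
  apply/measurable_EFinP; apply: measurable_enorm; exact: measurable_rowB.
rewrite !mean_distE.
apply: (@le_trans _ _ (\int[P]_w (a%:E * (e w)%:E + (((2 * c)^-1)%:E * (s w ^+ 2)%:E + cst (c / 2)%:E w)))%E).
  apply: ge0_le_integral => //.
  - by move=> w _; rewrite lee_fin enorm_ge0.
  - apply/measurable_EFinP; apply: measurable_enorm; exact: measurable_rowB.
  - apply: emeasurable_funD; first exact: measurable_funeM.
    by apply: emeasurable_funD; [exact: measurable_funeM|exact: measurable_cst].
  move=> w _; rewrite /= -!EFinM -!EFinD lee_fin.
  apply: le_trans (ler_enormB _ (prox_profile (X k w)) _) _.
  by rewrite [leLHS]addrC; exact: lerD (prox_profile_contraction (fX k w)) (amgm _ c0).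
have e_ge0 w : (0 <= (e w)%:E)%E by rewrite lee_fin enorm_ge0.
have s_ge0 w : (0 <= (s w ^+ 2)%:E)%E by rewrite lee_fin sqr_ge0.
have c2 : 0 <= (2 * c)^-1 by rewrite invr_ge0 mulr_ge0// ltW.
rewrite ge0_integralD//; last 4 first.
- by move=> w _; rewrite mule_ge0.
- exact: measurable_funeM.
- by move=> w _; rewrite adde_ge0 ?mule_ge0// lee_fin ltW// divr_gt0.
- by apply: emeasurable_funD; [exact: measurable_funeM|exact: measurable_cst].
rewrite ge0_integralZl_EFin// leeD2l// ge0_integralD//; last 3 first.
- by move=> w _; rewrite mule_ge0.
- exact: measurable_funeM.
- by move=> w _; rewrite lee_fin ltW// divr_gt0.
rewrite ge0_integralZl_EFin// integral_probability_cst.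
apply: le_trans (leeD2r _ (lee_wpmul2l _ (mean_inexactness k))) _; first by rewrite lee_fin.
rewrite -EFinM -EFinD lee_fin -/c.
have -> : N%:R * (eta ^+ k.+1) ^+ 2 = c ^+ 2 by rewrite /c exprMn sqr_sqrtr// ler0n.
by rewrite le_eqVlt; apply/orP; left; apply/eqP; field; rewrite gt_eqF.
Qed.

(** [B] is kept free because the starting bound is [C] or [sqrt N C], according to what is known of
    [x0]. *)
Lemma mean_dist_rate (c B : R) k : a <= c -> eta <= c ->
  (mean_dist xs x0 <= (Num.sqrt N%:R * B)%:E)%E ->
  (mean_dist xs (X k) <= (Num.sqrt N%:R * ((B + k%:R) * c ^+ k))%:E)%E.
Proof.
move=> ac ec; elim: k => [|k IH] m0; first by rewrite addr0 expr0 mulr1.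
have a0 : 0 <= a by exact: specnorm_ge0.
have c0 : 0 <= c by exact: le_trans ac.
apply: le_trans (mean_dist_step k) _.
apply: le_trans (leeD2r _ (lee_wpmul2l _ (IH m0))) _; first by rewrite lee_fin.
rewrite -EFinM -EFinD lee_fin mulrCA -mulrDr ler_wpM2l ?sqrtr_ge0//.
(* Replacing [a] by [c] requires [(B + k) c^k >= 0]; the sign comes from the distance that it
   bounds. *)
have : (mean_dist xs (X k) >= 0)%E.
  by rewrite mean_distE; apply: integral_ge0 => w _; rewrite lee_fin enorm_ge0.
move=> /le_trans/(_ (IH m0)); rewrite lee_fin pmulr_rge0 ?sqrtr_gt0 ?ltr0n// => ge0.
have -> : (B + k.+1%:R) * c ^+ k.+1 = c * ((B + k%:R) * c ^+ k) + c ^+ k.+1.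
  by rewrite -natr1 exprS; ring.
apply: lerD; first exact: ler_wpM2r.
by rewrite lerXn2r ?nnegrE// ltW.
Qed.

(** The norm is at most the sum of its [N] block norms, which costs a factor [sqrt N] compared with
    [sqrt N C]. *)
Lemma mean_dist_start (C : R) :
  (forall i, ('E_P[fun w => enorm (blk (x0 w) i - blk xs i)] <= C%:E)%E) ->
  (mean_dist xs x0 <= (Num.sqrt N%:R * (Num.sqrt N%:R * C))%:E)%E.
Proof.
move=> HC; rewrite mulrA -expr2 sqr_sqrtr ?ler0n//.
have mx0 : measurable_row x0 by exact: (mX 0).
have mi i : measurable_fun setT (fun w => (enorm (blk (x0 w) i - blk xs i))%:E).
  apply/measurable_EFinP; apply: measurable_enorm; apply: measurable_rowB; first exact: measurable_blk.
  by move=> b; exact: measurable_cst.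
rewrite mean_distE.
apply: (@le_trans _ _ (\int[P]_w \sum_i (enorm (blk (x0 w) i - blk xs i))%:E)%E).
  apply: ge0_le_integral => //.
  - by move=> w _; rewrite lee_fin enorm_ge0.
  - apply/measurable_EFinP; apply: measurable_enorm; exact: measurable_rowB.
  - exact: emeasurable_sum.
  move=> w _; rewrite sumEFin lee_fin enorm_blocks; apply: le_trans (enorm_le_sum _) _.
  by apply: ler_sum => i _; rewrite mxE ger0_norm ?enorm_ge0// blkB.
rewrite ge0_integral_sum//; last by move=> i w _; rewrite lee_fin enorm_ge0.
apply: (@le_trans _ _ (\sum_(i < N) C%:E)%E); last first.
  by rewrite sumEFin sumr_const card_ord mulr_natl.
by apply: lee_sum => i _; have := HC i; rewrite unlock.
Qed.

End Convergence.

(** * Iteration counts *)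

Section Complexity.
Context {R : realType}.

Lemma ln_inv_gt0 (q : R) : 0 < q < 1 -> 0 < ln (1 / q).
Proof. by move=> /andP[q0 q1]; rewrite ln_gt0// div1r invf_gt1. Qed.

Lemma DconstE (q c : R) : Dconst q c = 1 / (expR 1 * ln (q / c)).
Proof. by rewrite /Dconst ln_powR. Qed.

Lemma Dconst_gt0 (q c : R) : 0 < c -> c < q -> 0 < Dconst q c.
Proof.
move=> c0 cq; rewrite DconstE divr_gt0// mulr_gt0 ?expR_gt0// ln_gt0//.
by rewrite ltr_pdivlMr// mul1r.
Qed.

(* The maximum of k / rho^k over real k is 1 / (e ln rho), since e y <= exp y. *)
Lemma natr_le_exponential (rho : R) (k : nat) : 1 < rho ->
  k%:R <= 1 / (expR 1 * ln rho) * rho ^+ k.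
Proof.
move=> rho1; have l0 : 0 < ln rho by exact: ln_gt0.
have rho0 : 0 < rho by exact: lt_trans rho1.
rewrite -[X in X ^+ k]lnK ?posrE// -expRM_natl mulrAC mul1r.
rewrite ler_pdivlMr ?mulr_gt0 ?expR_gt0// mulrCA.
rewrite -[X in _ <= expR X](subrK 1) addrC expRD ler_pM2l ?expR_gt0//.
by apply: le_trans (expR_ge1Dx _); rewrite addrC subrK.
Qed.

(** The inductive step amounts to [1 + ln r <= r]. With [r = 1 / eta^2], this is where
    [ln (1 / eta^2)] enters the denominator of [ell]. *)
Lemma geometric_sum_le (r : R) (K : nat) : 1 < r ->
  \sum_(k < K) r ^+ k.+1 <= r ^+ K.+1 / ln r.
Proof.
move=> r1; have l0 : 0 < ln r by exact: ln_gt0.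
have r0 : 0 < r by exact: lt_trans r1.
elim: K => [|K IH]; first by rewrite big_ord0 divr_ge0// ltW// exprn_gt0.
rewrite big_ord_recr/=; apply: le_trans (lerD IH (lexx _)) _.
rewrite -[X in _ + X](mulfK (lt0r_neq0 l0)) -mulrDl ler_pM2r ?invr_gt0//.
rewrite -[X in X + _]mulr1 -mulrDr [leRHS]exprSr ler_wpM2l ?exprn_ge0 ?(ltW r0)//.
have : ln (1 + (r - 1)) <= r - 1 by apply: le_ln1Dx; lra.
have -> : 1 + (r - 1) = r by ring.
by lra.
Qed.

Lemma ell_exponent (S r q : R) : 0 < S -> expR (ln S / ln (1 / q) * ln r) = S `^ (ln r / ln (1 / q)).
Proof. by move=> S0; rewrite /powR gt_eqF//; congr expR; ring. Qed.

(** * Number of major iterations *)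

Section Horizon.
Context (q S : R) (q01 : 0 < q < 1) (S1 : 1 <= S).

(** The second summand of [ell] as a natural number; [S >= 1] keeps the ceiling nonnegative, so the
    absolute value changes nothing. *)
Definition horizon : nat := `|Num.ceil (ln S / ln (1 / q))|%N.

Let L := ln S / ln (1 / q).

Let L0 : 0 <= L.
Proof. by apply: divr_ge0; [exact: ln_ge0|exact/ltW/ln_inv_gt0]. Qed.

Lemma horizonE : horizon%:R = (Num.ceil L)%:~R :> R.
Proof. by rewrite /horizon natr_absz ger0_norm// ceil_ge0 (lt_le_trans _ L0)// ltrN10. Qed.

Lemma horizon_ge : L <= horizon%:R.
Proof. by rewrite horizonE ceil_ge. Qed.

Lemma horizon_lt : horizon%:R < L + 1.
Proof.
by rewrite horizonE; have /andP[] := ceil_itv L; rewrite intrB ltrBlDr.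
Qed.

Lemma expr_horizon_le : q ^+ horizon <= S^-1.
Proof.
have /andP[q0 q1] := q01.
have S0 : 0 < S by exact: lt_le_trans S1.
have lq := ln_inv_gt0 q01.
rewrite -[q]lnK ?posrE// -expRM_natl -[S^-1]lnK ?posrE ?invr_gt0// ler_expR lnV ?posrE//.
have := horizon_ge; rewrite /L ler_pdivrMr// div1r lnV ?posrE//.
by rewrite mulrN lerNr.
Qed.

(** Rounding up costs less than one iteration, so [horizon + 1 < L + 2]; for [r = 1 / eta^2] the
    factor [r^2] is the [eta^4] in the denominator of [ell]. *)
Lemma expr_horizon_ge (r : R) : 1 < r -> r ^+ horizon.+1 <= r ^+ 2 * S `^ (ln r / ln (1 / q)).
Proof.
move=> r1; have r0 : 0 < r by exact: lt_trans r1.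
have S0 : 0 < S by exact: lt_le_trans S1.
have l0 : 0 < ln r by exact: ln_gt0.
rewrite -ell_exponent// -[X in X ^+ horizon.+1]lnK ?posrE// -[X in X ^+ 2]lnK ?posrE//.
rewrite -!expRM_natl -expRD ler_expR -mulrDl ler_pM2r//.
by rewrite -natr1; have := horizon_lt; rewrite -/L; lra.
Qed.

End Horizon.

(** The successor keeps each count positive and at most [Q / eta^(2 (k + 1)) + 1]; these extra ones
    add up to the ceiling term of [ell]. *)
Definition sa_steps (Q eta : R) (k : nat) : nat := (Num.truncn (Q / (eta ^+ k.+1) ^+ 2)).+1.

Lemma sa_steps_accuracy (Q eta : R) (k : nat) : 0 < Q -> 0 < eta ->
  Q / (sa_steps Q eta k).+1%:R <= (eta ^+ k.+1) ^+ 2.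
Proof.
move=> Q0 e0; have e2 : 0 < (eta ^+ k.+1) ^+ 2 by rewrite !exprn_gt0.
rewrite ler_pdivrMr ?ltr0n// mulrC -ler_pdivrMr//.
by apply: le_trans (ltW (truncnS_gt _)) _; rewrite ler_nat.
Qed.

Lemma sa_steps_sum (N : nat) (Q C D eta q eps : R) :
  0 < Q -> 0 < eta < 1 -> 0 < q < 1 -> 1 <= Num.sqrt N%:R * (C + D) / eps ->
  (\sum_(k < horizon q (Num.sqrt N%:R * (C + D) / eps)) sa_steps Q eta k)%N%:R
    <= ell N Q C D eta q eps.
Proof.
move=> Q0 /andP[e0 e1] q01 S1; rewrite /ell; set S := _ / eps in S1 *.
rewrite -horizonE//; set K := horizon q S.
pose r := 1 / eta ^+ 2.
have r1 : 1 < r by rewrite /r div1r invf_gt1 ?exprn_gt0// exprn_ilt1// ltW.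
have l0 : 0 < ln r by exact: ln_gt0.
rewrite natr_sum.
apply: (@le_trans _ _ (\sum_(k < K) (Q * r ^+ k.+1 + 1))).
  apply: ler_sum => k _; rewrite /sa_steps -natr1 lerD2r.
  have -> : Q * r ^+ k.+1 = Q / (eta ^+ k.+1) ^+ 2.
    by rewrite /r div1r exprVn -!exprM mulnC.
  by rewrite truncn_le divr_ge0 ?sqr_ge0// ltW.
rewrite big_split/= sumr_const card_ord lerD2r -mulr_sumr.
apply: le_trans (ler_wpM2l (ltW Q0) (geometric_sum_le K r1)) _.
rewrite -/r.
have -> : Q / (eta ^+ 4 * ln r) * S `^ (ln r / ln (1 / q)) =
    Q * (r ^+ 2 * S `^ (ln r / ln (1 / q)) / ln r).
  rewrite /r; move: (ln _) l0 (S `^ _) => l l0 s; field.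
  by rewrite !gt_eqF.
by rewrite ler_pM2l// ler_pM2r ?invr_gt0// expr_horizon_ge.
Qed.

Lemma ell_bigOmega (N : nat) (Q C D eta q : R) :
  (0 < N)%N -> 0 < Q -> 0 < C + D -> 0 < eta < q -> q < 1 ->
  (fun eps : R => ell N Q C D eta q eps) =Omega_((0:R)^'+) (fun eps : R => 1 / eps ^+ 2).
Proof.
move=> N0 Q0 CD /andP[e0 eq] q1.
have q0 : 0 < q by exact: lt_trans eq.
have q01 : 0 < q < 1 by rewrite q0.
pose A := Num.sqrt N%:R * (C + D).
have A0 : 0 < A by rewrite mulr_gt0// sqrtr_gt0 ltr0n.
have e1 : eta < 1 by exact: lt_trans q1.
have l0 : 0 < ln (1 / eta ^+ 2) by rewrite ln_inv_gt0// exprn_gt0// exprn_ilt1// ltW.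
pose kap := Q / (eta ^+ 4 * ln (1 / eta ^+ 2)).
have kap0 : 0 < kap by rewrite divr_gt0// mulr_gt0// exprn_gt0.
(* The exponent is [2 ln eta / ln q], at least 2 because [eta < q < 1]. *)
have p2 : 2 <= ln (1 / eta ^+ 2) / ln (1 / q).
  have lt_ln : ln eta < ln q by rewrite ltr_ln.
  by rewrite ler_pdivlMr ?ln_inv_gt0// !div1r !lnV ?posrE ?exprn_gt0// lnXn//; lra.
rewrite eqOmegaE qualifE; apply/asboolP; exists (kap * A ^+ 2); first by rewrite mulr_gt0// exprn_gt0.
near=> eps.
have eps0 : 0 < eps by near: eps; exact: nbhs_right_gt.
have epsA : eps <= A by near: eps; exact: nbhs_right_le.
have S1 : 1 <= A / eps by rewrite ler_pdivlMr// mul1r.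
rewrite [`|1 / _|]ger0_norm ?divr_ge0 ?sqr_ge0//; apply: le_trans (ler_norm _).
rewrite /ell -/A -/kap.
apply: (@le_trans _ _ (kap * (A / eps) `^ (ln (1 / eta ^+ 2) / ln (1 / q)))); last first.
  by rewrite lerDl -horizonE.
rewrite -mulrA ler_pM2l//.
have -> : A ^+ 2 * (1 / eps ^+ 2) = (A / eps) `^ 2%:R.
  rewrite powR_mulrn; last by rewrite divr_ge0// ltW.
  by rewrite div1r expr_div_n.
exact: ler_powR.
Unshelve. all: by end_near. Qed.

Lemma balanced_rate_exists (a delta : R) : 0 < a < 1 -> 0 < delta ->
  exists q, a < q < 1 /\ Dconst q a = (1 + 2 * delta^-1) / (expR 1 * ln a^-1).
Proof.
move=> /andP[a0 a1] d0.
have l0 : 0 < ln a^-1 by rewrite -div1r ln_inv_gt0// a0.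
(* For [q = a^t] the exponent [ln (1 / a^2) / ln (1 / q)] is [2 / t = 2 + delta], while
   [1 / (1 - t) = 1 + 2 / delta] is the numerator of the prescribed [D]. *)
pose t := 2 / (2 + delta).
have t0 : 0 < t by rewrite divr_gt0// addr_gt0.
have t1 : t < 1 by rewrite ltr_pdivrMr ?addr_gt0// mul1r ltrDl.
have lna : ln a = - ln a^-1 by rewrite lnV ?posrE// opprK.
exists (a `^ t).
have q0 : 0 < a `^ t by exact: powR_gt0.
split.
  rewrite -ltr_ln ?posrE// ln_powR lna; apply/andP; split; first by nra.
  by rewrite -(ltr_ln (x := a `^ t)) ?posrE// ln_powR lna ln1; nra.
rewrite DconstE ln_div ?posrE// ln_powR lna.
have -> : t * - ln a^-1 - - ln a^-1 = ln a^-1 * (1 - t) by ring.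
rewrite /t; move: (ln a^-1) l0 (expR 1) (expR_gt0 (1 : R)) => l l0 e ep; field.
by rewrite !gt_eqF//= addr_gt0.
Qed.

(** The value of [D] determines [ln (q / a)], hence [ln (1 / q) = 2 / (2 + delta) * ln (1 / a)], so
    the stated bound holds with equality. *)
Lemma balanced_rate_ell (N : nat) (Q C a q delta eps : R) : 0 < a -> a < q < 1 -> 0 < delta ->
  let D := (1 + 2 * delta^-1) / (expR 1 * ln a^-1) in
  Dconst q a = D ->
  let S := Num.sqrt N%:R * (C + D) / eps in
  ell N Q C D a q eps =
    Q / (a ^+ 4 * ln (1 / a ^+ 2)) * S `^ (2 + delta)
    + (Num.ceil (ln S * ((2 + delta) / (2 * ln a^-1))))%:~R.
Proof.
move=> a0 /andP[aq q1] d0 D DE S.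
have q0 : 0 < q by exact: lt_trans aq.
have l0 : 0 < ln a^-1 by rewrite -div1r ln_inv_gt0// a0 (lt_trans aq).
have lqa : 0 < ln (q / a) by rewrite ln_gt0// ltr_pdivlMr// mul1r.
have lq : ln (1 / q) = 2 / (2 + delta) * ln a^-1.
  rewrite div1r lnV ?posrE//; move: DE lqa l0.
  rewrite DconstE /D ln_div ?posrE// lnV ?posrE//.
  move: (ln q) (ln a) (expR 1) (expR_gt0 (1 : R)) => u v e e0 E uv v0.
  have en := lt0r_neq0 e0; have uvn := lt0r_neq0 uv; have dn := lt0r_neq0 d0.
  have vn : v != 0 by rewrite -oppr_eq0 lt0r_neq0.
  have Ev : 1 / (e * (u - v)) * (e * (u - v) * - v) = - v.
    by field; rewrite ?en ?uvn.
  have Euv : (1 + 2 * delta^-1) / (e * - v) * (e * (u - v) * - v) = (u - v) * (1 + 2 * delta^-1).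
    by field; rewrite ?en ?vn ?dn.
  have : - v * delta = (u - v) * (delta + 2).
    transitivity ((u - v) * (1 + 2 * delta^-1) * delta); last by field.
    by rewrite -Euv -E Ev.
  move=> H; have d2 : 2 + delta != 0 by rewrite gt_eqF// addr_gt0.
  apply: (mulIf d2); have -> : 2 / (2 + delta) * - v * (2 + delta) = 2 * - v by field.
  by move: H; lra.
have ln0 := lt0r_neq0 l0; have d2n : 2 + delta != 0 by rewrite gt_eqF// addr_gt0.
have e1 : ln (1 / a ^+ 2) / ln (1 / q) = 2 + delta.
  rewrite lq div1r -exprVn lnXn ?invr_gt0// -mulr_natl.
  by field; rewrite ?ln0 ?d2n.
have e2 : ln S / ln (1 / q) = ln S * ((2 + delta) / (2 * ln a^-1)).
  by rewrite lq; field; rewrite ?ln0 ?d2n.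
by rewrite /ell -/S e1 e2.
Qed.

End Complexity.

(** Write [rho^k = s^k * s^k]: one factor dominates the growth of [A + k] up to a constant, the
    other eventually outgrows that constant. *)
Lemma eventually_le_exponential (R : realType) (A B rho : R) : 0 <= A -> 0 < B -> 1 < rho ->
  exists k0, forall k, (k0 <= k)%N -> A + k%:R <= B * rho ^+ k.
Proof.
move=> A0 B0 rho1; pose s := Num.sqrt rho.
have s1 : 1 < s by rewrite -sqrtr1 ltr_sqrt// (lt_trans ltr01).
have s0 : 0 < s by exact: lt_trans s1.
have sE : s ^+ 2 = rho by rewrite sqr_sqrtr// ltW// (lt_trans ltr01).
pose Ds := 1 / (expR 1 * ln s).
have Ds0 : 0 < Ds by rewrite divr_gt0// mulr_gt0 ?expR_gt0// ln_gt0.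
exists (Num.truncn ((A + Ds) / B * Ds)).+1 => k kk.
have ks := natr_le_exponential k s1; rewrite -/Ds in ks.
have sk1 : 1 <= s ^+ k by rewrite exprn_ege1// ltW.
apply: (@le_trans _ _ ((A + Ds) * s ^+ k)).
  by rewrite mulrDl lerD// ler_peMr.
rewrite -sE -exprM mulnC exprM expr2 mulrA ler_pM2r ?exprn_gt0//.
rewrite mulrC -ler_pdivrMr// -(ler_pM2r Ds0); apply: le_trans (_ : k%:R <= _).
  by apply: le_trans (ltW (truncnS_gt _)) _; rewrite ler_nat.
by rewrite mulrC.
Qed.

Lemma horizon_lower (R : realType) (q S : R) (k0 : nat) : 0 < q < 1 -> 1 <= S ->
  q ^+ k0 * S >= 1 -> (k0 <= horizon q S)%N.
Proof.
move=> q01 S1 qS; have /andP[q0 q1] := q01.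
have S0 : 0 < S by exact: lt_le_trans S1.
rewrite -(ler_nat R); apply: le_trans (horizon_ge q01 S1).
rewrite ler_pdivlMr ?ln_inv_gt0// div1r lnV ?posrE//.
by have := ln_ge0 qS; rewrite lnM ?posrE ?exprn_gt0// lnXn// -mulr_natl; lra.
Qed.

Theorem theorem1 (R : realType) (d : measure_display) (T : measurableType d)
    (P : probability T R) (G : sgame P) (mu : R) (M : 'I_(nplayers G) -> R)
    (xs : profile G) (C eta : R)
    (N0 : (0 < nplayers G)%N) (mu0 : 0 < mu)
    (wpG : well_posed G) (HA : assumptionA M) (HB : assumptionB G mu)
    (Hxs : nash xs) (C0 : 0 <= C) (eta01 : 0 < eta < 1) :
  let N := nplayers G in
  let a := specnorm (Gamma G mu) in
  let c := Num.max a eta in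
  let Q := Qconst mu M in
  (* (a) *)
  (exists j : 'I_N -> nat -> nat,
    [/\ forall i k, (0 < j i k)%N,
        forall (x0 : T -> profile G) smp, sa_run j x0 smp ->
          inexact mu j x0 smp (fun _ k => eta ^+ k.+1)
      & forall q, c < q < 1 ->
        let D := Dconst q c in
        exists2 eps0 : R, 0 < eps0 &
        forall eps, 0 < eps <= Num.sqrt N%:R * (C + D) ->
        exists K : nat,
          (forall i, (\sum_(k < K) j i k)%N%:R <= ell N (Q i) C D eta q eps) /\
          (forall (x0 : T -> profile G) smp, sa_run j x0 smp ->
             (forall i, ('E_P[fun w => enorm (blk (x0 w) i - blk xs i)]
                         <= C%:E)%E) ->
             (eps <= eps0 \/
              (mean_dist xs x0 <= (Num.sqrt N%:R * C)%:E)%E) ->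
             eps_NE2 xs eps (sa_iter mu j x0 smp K))]) /\
  (* (b) *)
  (forall q, c < q < 1 -> forall i,
     (fun eps : R => ell N (Q i) C (Dconst q c) eta q eps)
       =Omega_((0:R)^'+) (fun eps : R => 1 / eps ^+ 2)) /\
  (forall delta, 0 < delta ->
     let D := (1 + 2 * delta^-1) / (expR 1 * ln a^-1) in
     (exists q, a < q < 1 /\ Dconst q a = D) /\
     (forall q, a < q < 1 -> Dconst q a = D -> forall i eps, 0 < eps ->
        let S := Num.sqrt N%:R * (C + D) / eps in
        ell N (Q i) C D a q eps <=
          Q i / (a ^+ 4 * ln (1 / a ^+ 2)) * S `^ (2 + delta)
          + (Num.ceil (ln S * ((2 + delta) / (2 * ln a^-1))))%:~R)).
Proof.
move=> N a c Q.
have [bc a1] := HB; rewrite -/a in a1.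
have fxs : feasible xs by case: Hxs.
have /andP[e0 e1] := eta01.
have a0 : 0 < a by exact: (specnorm_Gamma_gt0 HA mu0 N0 fxs).
have Q0 i : 0 < Q i by exact: (Qconst_gt0 HA mu0).
have ac : a <= c by rewrite le_max lexx.
have ec : eta <= c by rewrite le_max lexx orbT.
have c0 : 0 < c by exact: lt_le_trans ec.
split; last split.
- pose j i k := sa_steps (Q i) eta k.
  have jeta i k : Q i / (j i k).+1%:R <= (eta ^+ k.+1) ^+ 2 by exact: sa_steps_accuracy.
  exists j; split => //.
    by move=> x0 smp run; exact: (sa_run_inexact HA wpG mu0 bc fxs run).
  move=> q /andP[cq q1] D.
  have q0 : 0 < q by exact: lt_trans cq.
  have q01 : 0 < q < 1 by rewrite q0.
  have D0 : 0 < D by exact: Dconst_gt0.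
  have CD : 0 < C + D by rewrite ltr_wpDl.
  have sN : 0 < Num.sqrt (N%:R : R) by rewrite sqrtr_gt0 ltr0n.
  have A0 : 0 < Num.sqrt N%:R * (C + D) by rewrite mulr_gt0.
  have rho1 : 1 < q / c by rewrite ltr_pdivlMr// mul1r.
  have [k0 Hk0] := eventually_le_exponential (mulr_ge0 (ltW sN) C0) CD rho1.
  (* For [eps] below this threshold [q^k0 * S >= 1], which forces at least [k0] major iterations. *)
  exists (Num.sqrt N%:R * (C + D) * q ^+ k0); first by rewrite mulr_gt0// exprn_gt0.
  move=> eps /andP[eps0 epsA].
  set S := Num.sqrt N%:R * (C + D) / eps.
  have S1 : 1 <= S by rewrite ler_pdivlMr// mul1r.
  exists (horizon q S); split; first by move=> i; exact: sa_steps_sum.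
  move=> x0 smp run E0 start; set K := horizon q S.
  (* Both branches meet here. With [B = C] the bound holds for every [K], by the choice of [D]; with
     [B = sqrt N C] it relies on [K >= k0]. *)
  have [B [m0 BK]] : exists B, (mean_dist xs x0 <= (Num.sqrt N%:R * B)%:E)%E /\
      B + K%:R <= (C + D) * (q / c) ^+ K.
    case: start => [epsk|m0]; last first.
      exists C; split => //; rewrite mulrDl lerD//.
        by rewrite ler_peMr// exprn_ege1// ltW.
      by rewrite /D DconstE; exact: natr_le_exponential.
    exists (Num.sqrt N%:R * C); split.
      exact: (mean_dist_start HA wpG mu Hxs run E0).
    apply: Hk0; apply: horizon_lower => //.
    by rewrite /S mulrA ler_pdivlMr// mul1r mulrC.
  rewrite /eps_NE2; apply: le_trans (mean_dist_rate HA wpG mu0 bc N0 Hxs run _ e0 jeta K ac ec m0) _ => //.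
  rewrite lee_fin.
  apply: (@le_trans _ _ (Num.sqrt N%:R * ((C + D) * q ^+ K))).
    rewrite ler_pM2l//; apply: le_trans (ler_wpM2r (exprn_ge0 K (ltW c0)) BK) _.
    by rewrite -mulrA -exprMn divfK// gt_eqF.
  rewrite mulrA; apply: le_trans (ler_wpM2l (ltW A0) (expr_horizon_le q01 S1)) _.
  by rewrite /S invf_div mulrCA mulfV ?mulr1// gt_eqF.
- move=> q /andP[cq q1] i; apply: ell_bigOmega => //.
    by rewrite ltr_wpDl// Dconst_gt0.
  by rewrite e0 (le_lt_trans ec).
- move=> delta d0 D; split; first by apply: balanced_rate_exists => //; rewrite a0.
  move=> q aq DE i eps _ /=.
  by rewrite (balanced_rate_ell N (Q i) C eps a0 aq d0 DE).
Qed.
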